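(* Let $u_0\in\mathfrak g_{-\infty}$, let $$\varphi^\infty(t,x)=x+\int_{-\infty}^x\left(e^{t\,u_0'(y)}-1\right)dy,$$ and let $u^\infty=\varphi^\infty_t\circ(\varphi^\infty)^{-1}$ be the associated vector field. Then $u=u^\infty$ satisfies the equation $$u_{xt}+u_{xx}u=0,$$ which is the Eulerian version of the equation $\left(\frac{\varphi_{tx}}{\varphi_x}\right)_t=0$. By differentiating, this equation is equivalent to the generalized Proudman--Johnson equation $$u_{txx}+(1+2\lambda)u_xu_{xx}+uu_{xxx}=0$$ with $\lambda=0$. The derivative of the vector field satisfies $$u^\infty_x(t,x)=u_0'\left((\varphi^\infty)^{-1}(t,x)\right),$$ and thus the $\dot W^{1,\infty}$-norm $\|u^\infty_x(t,\cdot)\|_{L^\infty}$ of $u^\infty$ is preserved along the flow.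
   Context: $W^{\infty,1}(\mathbb R)=\bigcap_{k\ge 0}W^{k,1}(\mathbb R)$; $\mathfrak g_{-\infty}=\{u: u'\in W^{\infty,1}(\mathbb R),\ \lim_{x\to-\infty}u(x)=0\}$. For each $t$, $\varphi^\infty(t,\cdot)$ is a diffeomorphism of $\mathbb R$, and $(\varphi^\infty)^{-1}(t,\cdot)$ denotes its inverse, so that $u^\infty(t,x)=\varphi^\infty_t\left(t,(\varphi^\infty)^{-1}(t,x)\right)$. Subscripts $t,x$ denote partial derivatives. The generalized Proudman--Johnson equation is considered for $u(t,\cdot)\in\mathfrak g_{-\infty}$. *)

(* Defs.v *)
From HB Require Import structures.
From mathcomp Require Import all_boot all_order all_algebra.
From mathcomp Require Import all_classical all_reals all_analysis.

Set Implicit Arguments.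
Unset Strict Implicit.
Unset Printing Implicit Defensive.

Import Order.TTheory GRing.Theory Num.Theory.
Import numFieldNormedType.Exports.

Local Open Scope ring_scope.
Local Open Scope classical_set_scope.

Section one_variable.
Context {R : realType}.
Implicit Types f g u : R -> R.

Definition smooth f : Prop := forall (n : nat) (x : R), derivable f^`(n) x 1.

Definition test_function f : Prop :=
  smooth f /\ compact (closure [set x | f x != 0]).

Definition L1 f : Prop :=
  (@lebesgue_measure R).-integrable [set: R] (EFin \o f).

Definition weak_derivative (i : nat) f g : Prop :=
  forall phi, test_function phi ->
    \int[@lebesgue_measure R]_x (f x * phi^`(i)%classic x) =
    (-1) ^+ i * \int[@lebesgue_measure R]_x (g x * phi x).

(* The Sobolev space W^{k,1}(R), on representatives: membership only depends
   on the class of a measurable f modulo equality almost everywhere. *)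
Definition sobolev1 (k : nat) f : Prop :=
  L1 f /\ forall i, (i <= k)%N -> exists2 g, L1 g & weak_derivative i f g.

Definition sobolev1_infty f : Prop := forall k, sobolev1 k f.

(* By the Sobolev embedding, a function whose derivative lies in W^{oo,1}(R)
   has exactly one continuous representative, and this one is of class C^oo;
   the elements of the Lie algebra g_{-oo} are these representatives, so that
   u' is the ordinary derivative. *)
Definition g_minus_infty u : Prop :=
  [/\ smooth u, sobolev1_infty u^`() & u x @[x --> -oo%R] --> (0 : R)].

Definition inverse f : R -> R := 'pinv_(fun=> 0) [set: R] f.

Definition diffeomorphism f : Prop :=
  [/\ bijective f, smooth f & smooth (inverse f)].

Definition Linfty_norm f : \bar R := 'N[@lebesgue_measure R]_+oo%E[EFin \o f]%E.

End one_variable.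

(* Functions of (t, x) are curried, with the time t as first argument. *)
Section time_dependent.
Context {R : realType}.
Implicit Types (J : set R) (f u phi : R -> R -> R).

Definition dt f : R -> R -> R := fun t x => (f ^~ x)^`() t.

Definition dx f : R -> R -> R := fun t x => (f t)^`() x.

(* The partial derivative of f prescribed by a word: true stands for d/dt and
   false for d/dx, the last letter being applied first. *)
Definition partial (w : seq bool) f : R -> R -> R :=
  foldr (fun b => if b then dt else dx) f w.

(* f is of class C^oo on J x R (J open): all iterated partial derivatives, in
   any order, exist and are jointly continuous. *)
Definition smooth_on J f : Prop :=
  forall (w : seq bool) (t x : R), J t ->
    [/\ derivable (partial w f ^~ x) t 1,
        derivable (partial w f t) x 1
      & {for (t, x), continuous (fun p : R * R => partial w f p.1 p.2)}].

Definition smooth_flow J phi : Prop :=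
  smooth_on J phi /\ forall t, J t -> diffeomorphism (phi t).

Definition flow_inverse phi : R -> R -> R := fun t => inverse (phi t).

(* u = phi_t o phi^{-1} *)
Definition velocity phi : R -> R -> R :=
  fun t x => dt phi t (flow_inverse phi t x).

(* The time-dependent vector fields among which solutions are considered. *)
Definition admissible_field J u : Prop :=
  smooth_on J u /\ forall t, J t -> g_minus_infty (u t).

Definition eulerian_equation J u : Prop :=
  forall t x, J t -> dt (dx u) t x + dx (dx u) t x * u t x = 0.

Definition lagrangian_equation J phi : Prop :=
  forall t x, J t -> dt (fun s y => dx (dt phi) s y / dx phi s y) t x = 0.

Definition generalized_proudman_johnson (lambda : R) J u : Prop :=
  forall t x, J t ->
    dx (dx (dt u)) t x + (1 + 2 * lambda) * dx u t x * dx (dx u) t x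
    + u t x * dx (dx (dx u)) t x = 0.

Definition phi_infty (u0 : R -> R) : R -> R -> R :=
  fun t x => x + \int[@lebesgue_measure R]_(y in `]-oo, x])
                   (expR (t * u0^`()%classic y) - 1).

Definition u_infty (u0 : R -> R) : R -> R -> R := velocity (phi_infty u0).

End time_dependent.

(* Main.v *)
(* Along phi^oo, phi_tx / phi_x = u0' is constant in time, which is the
   Lagrangian equation; for a smooth flow phi with velocity u, the chain rule
   turns u_xt + u_xx u at phi(t, x) into (phi_tx / phi_x)_t. Differentiation of
   the Eulerian equation in x gives the Proudman-Johnson equation with
   lambda = 0. Conversely, the latter makes u_xt + u_xx u a function c(t); as
   u, u_x, u_xx -> 0 when x -> -oo, the functions u_x(., -n) tend to 0 pointwise
   and their time derivatives to c, so c = 0 by Baire's theorem.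
   Weak derivatives of smooth functions are classical derivatives by the lemma
   of du Bois-Reymond. With psi the inverse of phi^oo(t, .), psi' is
   exp (- t u0') o psi, so each derivative of u0' o psi is a o psi for a bounded
   smooth integrable a; change of variables then gives its integrability. *)
Require Import Defs.
From HB Require Import structures.
From mathcomp Require Import all_boot all_order all_algebra.
From mathcomp Require Import all_classical all_reals all_analysis.
From mathcomp Require Import measurable_realfun ess_sup_inf.
From mathcomp Require Import ring lra.

Set Implicit Arguments.
Unset Strict Implicit.
Unset Printing Implicit Defensive.

Import Order.TTheory GRing.Theory Num.Theory.
Import numFieldNormedType.Exports.

Local Open Scope ring_scope.
Local Open Scope classical_set_scope.

(** * Derivatives of functions of one variable *)

(** The equations themselves are short; most of the work is regularity in [(t, x)]. A diffeomorphism
    for each [t] gives an inverse smooth in [x] only, so differentiability of the inverse in [t] has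
    to be derived: continuity comes from strict monotonicity, then a mean value slope in the sense
    of Carathéodory is solved for the increment of the inverse. For [phi_infty], both first
    derivatives of the inverse are smooth functions of [t] and of the inverse itself, so each order
    of regularity yields the next one. Baire's theorem enters because membership in the Lie algebra
    is imposed at each [t] separately: the limits at -oo carry no uniformity in [t], and a pointwise
    limit does not commute with d/dt by itself. Smoothness is an infinite conjunction on which no
    induction runs; it is therefore cut into the finite-order predicates [derivs] and
    [joint_derivs], for which stability under sums, products and composition is an induction on the
    order. *)

Lemma is_derive_derive1 (R : realType) (f : R -> R) (x : R) :
  derivable f x 1 -> is_derive x 1 f (f^`() x).
Proof. by move=> df; rewrite derive1E; exact: derivableP. Qed.

Lemma derivable_continuous (R : realType) (f : R -> R) (x : R) :
  derivable f x 1 -> {for x, continuous f}.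
Proof. by move=> /derivable1_diffP /differentiable_continuous. Qed.

Lemma derive1_is_derive (R : realType) (f : R -> R) (x d : R) :
  is_derive x 1 f d -> f^`() x = d.
Proof. by move=> [_ <-]; rewrite derive1E. Qed.

(** The parameter [P] is a property carried by every derivative up to order [n]: trivial for plain
    smoothness, later [bounded_continuous] or [bounded_L1]. *)
Fixpoint derivs (R : realType) (P : (R -> R) -> Prop) (n : nat) (f : R -> R) :
    Prop :=
  [/\ P f, forall x, derivable f x 1
    & if n is m.+1 then derivs P m f^`() else True].

Section derivs.
Context {R : realType}.
Implicit Types (P Q : (R -> R) -> Prop) (f g : R -> R).

Lemma derivsP P f :
  (forall n, derivs P n f) <-> smooth f /\ forall n, P f^`(n).
Proof.
split=> [Pf|[+ +] n].
  suff H n : P f^`(n) /\ forall x, derivable f^`(n) x 1.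
    by split=> n; have [] := H n.
  elim: n f Pf => [|n IH] f Pf; first by have [] := Pf 0%N.
  by rewrite derive1Sn; apply: IH => m; have [] := Pf m.+1.
elim: n f => [|n IH] f sf Pf; split; [exact: (Pf 0%N)|exact: (sf 0%N)|by []| | |].
- exact: (Pf 0%N).
- exact: (sf 0%N).
- by apply: IH => m; rewrite -derive1Sn; [exact: sf|exact: Pf].
Qed.

Lemma derivsW P n f : derivs P n.+1 f -> derivs P n f.
Proof.
elim: n f => [|n IH] f [Pf df]; first by move=> _; split.
by move=> /IH; split.
Qed.

Lemma derivs_impl P Q n f : (forall u, P u -> Q u) -> derivs P n f ->
  derivs Q n f.
Proof.
move=> PQ; elim: n f => [|n IH] f [Pf df f']; split=> //; try exact: PQ.
exact: IH.
Qed.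

Lemma derivsD P n f g : (forall u v, P u -> P v -> P (u + v)) ->
  derivs P n f -> derivs P n g -> derivs P n (f + g).
Proof.
move=> PD; have dD (u v : R -> R) : (forall x, derivable u x 1) ->
    (forall x, derivable v x 1) -> forall x, derivable (u + v) x 1.
  by move=> du dv x; exact: derivableD.
elim: n f g => [|n IH] f g [Pf df f'] [Pg dg g'].
  by split; [exact: PD|exact: dD|].
split; [exact: PD|exact: dD|].
suff -> : (f + g)^`() = f^`()%classic + g^`()%classic by exact: IH.
apply/funext => x; apply: derive1_is_derive.
by apply: is_deriveD; exact: is_derive_derive1.
Qed.

(** Two predicates, because integrable factors form a module over bounded ones: in [f * g' + f' * g]
    the left factor always keeps [P] and the right one [Q]. *)
Lemma derivsM P Q n f g : (forall u v, P u -> P v -> P (u + v)) ->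
  (forall u v, P u -> Q v -> P (u * v)) ->
  derivs P n f -> derivs Q n g -> derivs P n (f * g).
Proof.
move=> PD PM; elim: n f g => [|n IH] f g.
  move=> [Pf df f'] [Pg dg g']; split; [exact: PM| |by []].
  by move=> x; exact: derivableM.
move=> hf hg; have [Pf df f'] := hf; have [Pg dg g'] := hg; split.
- exact: PM.
- by move=> x; exact: derivableM.
suff -> : (f * g)^`() = f * g^`()%classic + f^`()%classic * g.
  by apply: derivsD => //; apply: IH => //; exact: derivsW.
apply/funext => x; apply: derive1_is_derive.
have /= := is_deriveM (is_derive_derive1 (df x))
  (is_derive_derive1 (dg x)).
by move=> h; apply: is_derive_eq h _; rewrite /GRing.scale/= [g x * _]mulrC.
Qed.

End derivs.

Lemma smooth_derivs (R : realType) (f : R -> R) :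
  smooth f <-> forall n, derivs (fun=> True) n f.
Proof. by split=> [sf|/derivsP[]//]; exact/derivsP. Qed.

Lemma smoothM (R : realType) (f g : R -> R) : smooth f -> smooth g ->
  smooth (f * g).
Proof.
move=> /smooth_derivs sf /smooth_derivs sg; apply/smooth_derivs => n.
exact: derivsM.
Qed.

Lemma smooth_continuous (R : realType) (f : R -> R) n : smooth f ->
  continuous f^`(n).
Proof. by move=> sf x; exact/derivable_continuous/sf. Qed.

Lemma smooth_derive1n (R : realType) (f : R -> R) n : smooth f ->
  smooth f^`(n).
Proof.
move=> sf m x; suff -> : f^`(n)^`(m) = f^`(n + m) by exact: sf.
by elim: m => [|m IH]; rewrite ?addn0// addnS derive1nS IH.
Qed.

(** * Test functions *)

Section derivs_comp.
Context {R : realType}.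
Implicit Types f g : R -> R.

Lemma derivs_cst n (a : R) : derivs (fun=> True) n (cst a).
Proof.
elim: n a => [|n IH] a; split=> //; try by move=> x; exact: derivable_cst.
by suff -> : (cst a)^`() = cst 0 by []; apply/funext => x; rewrite derive1_cst.
Qed.

Lemma smooth_cst (a : R) : smooth (cst a).
Proof. by apply/smooth_derivs => n; exact: derivs_cst. Qed.

Lemma smooth_id : smooth (@id R).
Proof.
apply/smooth_derivs => -[|n]; split=> //; try by move=> x; exact: derivable_id.
suff -> : id^`() = cst 1 :> (R -> R) by exact: derivs_cst.
by apply/funext => x; rewrite derive1_id.
Qed.

Lemma derivs_comp n f g : derivs (fun=> True) n f -> derivs (fun=> True) n g ->
  derivs (fun=> True) n (f \o g).
Proof.
have dfg (h k : R -> R) x : derivable h (k x) 1 -> derivable k x 1 ->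
    is_derive x 1 (h \o k) (h^`()%classic (k x) * k^`()%classic x).
  by move=> /is_derive_derive1 ? /is_derive_derive1 ?; exact: is_derive1_comp.
elim: n f g => [|n IH] f g hf hg; have [_ df f'] := hf; have [_ dg g'] := hg.
  by split=> [//|x|//]; have [] := dfg f g x (df _) (dg _).
split; [by []|by move=> x; have [] := dfg f g x (df _) (dg _)|].
suff -> : (f \o g)^`() = (f^`()%classic \o g) * g^`()%classic.
  by apply: (derivsM (Q := fun=> True)) => //; apply: IH => //; exact: derivsW.
by apply/funext => x; apply: derive1_is_derive; exact: dfg.
Qed.

Lemma smooth_comp f g : smooth f -> smooth g -> smooth (f \o g).
Proof.
move=> /smooth_derivs sf /smooth_derivs sg; apply/smooth_derivs => n.
exact: derivs_comp.
Qed.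

Lemma smoothD f g : smooth f -> smooth g -> smooth (f + g).
Proof.
move=> /smooth_derivs sf /smooth_derivs sg; apply/smooth_derivs => n.
exact: derivsD.
Qed.

End derivs_comp.

(** * The flat function exp(-c/x) and its derivatives *)

Section expinv.
Context {R : realType}.
Implicit Types (c x : R) (P : {poly R}).

(** The polynomial in 1/x makes the family closed under differentiation, so that smoothness becomes
    an induction over all [P]. *)
Definition expinv c P x : R :=
  if 0 < x then P.[x^-1] * expR (- (c / x)) else 0.

Lemma expRN_ler x : 0 < x -> x * expR (- x) <= 1.
Proof.
move=> x0; rewrite expRN ler_pdivrMr ?expR_gt0// mul1r.
by apply: le_trans (expR_ge1Dx x); rewrite lerDr.
Qed.

(** Horner induction on [P]: each factor 1/x is absorbed by one half of the exponential, the other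
    half being left to the induction hypothesis, which is why [c] is generalized. The linear bound
    is what makes the function continuous at 0. *)
Lemma expinv_le P c : 0 < c ->
  exists2 K, 0 <= K & forall x, 0 < x -> `|expinv c P x| <= K * x.
Proof.
elim/poly_ind: P c => [|P a IH] c c0.
  by exists 0 => // x x0; rewrite /expinv x0 horner0 mul0r normr0 mul0r.
have c20 : 0 < c / 2 by rewrite divr_gt0.
have [K K0 KP] := IH _ c20.
have dec d x : 0 < d -> 0 < x -> x^-1 * expR (- (d / x)) <= d^-1.
  move=> d0 x0; rewrite -(ler_pM2l d0) divff ?gt_eqF// mulrA.
  by apply: expRN_ler; rewrite divr_gt0.
exists (K / (c / 2) + `|a| / c).
  by rewrite addr_ge0// mulr_ge0// invr_ge0 ltW.
move=> x x0; have := KP x x0; rewrite /expinv x0 hornerMXaddC => {}KP.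
have -> : (P.[x^-1] * x^-1 + a) * expR (- (c / x)) =
    P.[x^-1] * expR (- (c / 2 / x)) * (x^-1 * expR (- (c / 2 / x))) +
    a * (x * (x^-1 * expR (- (c / x)))).
  have -> : - (c / x) = - (c / 2 / x) + - (c / 2 / x).
    by field; rewrite gt_eqF.
  by rewrite expRD; field; rewrite gt_eqF.
have ce d : 0 < d -> 0 <= x^-1 * expR (- (d / x)).
  by move=> d0; rewrite mulr_ge0 ?expR_ge0// invr_ge0 ltW.
rewrite (le_trans (ler_normD _ _))// mulrDl lerD//.
  rewrite normrM (ger0_norm (ce _ c20)) [leRHS]mulrAC.
  by rewrite ler_pM ?normr_ge0 ?ce ?dec.
rewrite normrM -mulrA ler_wpM2l// ger0_norm ?mulr_ge0 ?(ltW x0) ?expR_ge0//.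
  by rewrite mulrC ler_wpM2r ?(ltW x0)// dec.
by rewrite invr_ge0 ltW.
Qed.

Lemma expinv_derive c P x : 0 < c ->
  is_derive x 1 (expinv c P) (expinv c ('X^2 * (c *: P - P^`())) x).
Proof.
move=> c0; have [x0|x0|->] := ltgtP x 0.
- rewrite {2}/expinv ltNge (ltW x0)/=.
  apply: (@near_eq_is_derive _ _ _ (cst 0)).
  near=> y; rewrite /expinv ltNge ifF//; apply/negbTE; rewrite negbK.
  by near: y; exact: lt_le_nbhsl.
- rewrite {2}/expinv x0.
  apply: (@near_eq_is_derive _ R R
    (fun y : R => P.[y^-1] * expR (- (c * y^-1)) : R)).
    by near=> y; rewrite /expinv ifT//; near: y; exact: lt_nbhsr.
  have iV : is_derive x 1 (fun y : R => y^-1) (- x ^- 2 *: 1).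
    by apply: is_deriveV; rewrite gt_eqF.
  have iP : is_derive x^-1 1 (horner P) (P^`()).[x^-1].
    by rewrite derivE; apply: is_derive_derive1; exact: derivable_horner.
  have iPV := is_derive1_comp iP iV.
  have icV := is_deriveN (is_deriveZ c iV).
  have iE := is_derive1_comp (is_derive_expR _) icV.
  apply: (is_derive_eq (is_deriveM iPV iE)).
  rewrite /GRing.scale/= !hornerE /= /GRing.scale/= exprVn.
  by field; rewrite gt_eqF.
- have E0 Q : expinv c Q 0 = 0 by rewrite /expinv ltxx.
  (* Dividing by [z - 0] amounts to replacing [P] by ['X * P]; the quotient stays in the family and
     tends to 0 by the linear bound. *)
  apply/is_derive1_caratheodory; exists (expinv c ('X * P)).
  rewrite !E0; split=> //.
    move=> z; rewrite !subr0 /expinv; case: ifPn; last by rewrite mul0r.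
    by move=> z0; rewrite !hornerE; field; rewrite gt_eqF.
  have [K K0 KP] := expinv_le ('X * P) c0.
  rewrite /prop_for /continuous_at E0; apply/cvgrPdist_le => e e0; near=> y.
  rewrite sub0r normrN; have [y0|y0] := ltP 0 y; last first.
    by rewrite /expinv ltNge y0/= normr0 ltW.
  rewrite (le_trans (KP _ y0))//.
  rewrite (@le_trans _ _ ((K + 1) * y))// ?ler_wpM2r ?lerDl// ?(ltW y0)//.
  rewrite mulrC -ler_pdivlMr ?ltr_wpDl// ltW//.
  by near: y; apply: lt_nbhsl; rewrite divr_gt0// ltr_wpDl.
Unshelve. all: by end_near. Qed.

Lemma smooth_expinv c P : 0 < c -> smooth (expinv c P).
Proof.
move=> c0; apply/smooth_derivs => n.
elim: n P => [|n IH] P; split=> //; try by move=> x; have [] := expinv_derive P x c0.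
suff -> : (expinv c P)^`() = expinv c ('X^2 * (c *: P - P^`())) by exact: IH.
by apply/funext => x; apply: derive1_is_derive; exact: expinv_derive.
Qed.

End expinv.

Section smooth_bump_theory.
Context {R : realType}.
Notation mu := (@lebesgue_measure R).
Implicit Types (a b c x : R) (h : R -> R).

(** Here [c] is the approximation parameter: as it tends to 0 the bumps tend pointwise to the
    indicator of []a, b[], while the support stays in [[a, b]] and the values in [0, 1]. *)
Definition smooth_bump c a b x := expinv c 1 (x - a) * expinv c 1 (b - x).

Lemma bump_notin c a b x : ~ `]a, b[%classic x -> smooth_bump c a b x = 0.
Proof.
rewrite /= in_itv/= => /negP; rewrite negb_and -!leNgt /smooth_bump /expinv.
by case/orP => ?; [rewrite ifN ?mul0r|rewrite [X in _ * X]ifN ?mulr0];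
  rewrite // subr_gt0 -leNgt.
Qed.

Lemma expinv1_ge0_le1 c x : 0 < c -> 0 <= expinv c 1 x <= 1.
Proof.
move=> c0; rewrite /expinv; case: ifPn => x0; last by rewrite lexx ler01.
rewrite hornerC mul1r expR_ge0 -[leRHS]expR0 ler_expR oppr_le0.
by rewrite divr_ge0 ?ltW.
Qed.

Lemma bump_norm_le1 c a b x : 0 < c -> `|smooth_bump c a b x| <= 1.
Proof.
move=> c0; rewrite /smooth_bump normrM.
have /andP[p0 p1] := expinv1_ge0_le1 (x - a) c0.
have /andP[q0 q1] := expinv1_ge0_le1 (b - x) c0.
by rewrite !ger0_norm// mulr_ile1.
Qed.

Lemma test_bump c a b : 0 < c -> test_function (smooth_bump c a b).
Proof.
move=> c0; split; last first.
  apply: (subclosed_compact _ (@segment_compact _ a b)).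
    exact: closed_closure.
  have /closure_id -> : closed `[a, b] by exact: interval_closed.
  apply: closure_subset => x /= xab; apply: contrapT => nxab.
  move: xab; rewrite bump_notin ?eqxx// => xab; apply: nxab.
  exact: subset_itv_oo_cc.
have -> : smooth_bump c a b =
    (expinv c 1 \o (@id R + cst (- a))) * (expinv c 1 \o (cst b + cst (-1) * id)).
  by apply/funext => x; rewrite /smooth_bump -[in LHS](mulN1r x).
have se : smooth (expinv c 1) by exact: smooth_expinv.
have sa := smooth_comp se (smoothD (@smooth_id R) (@smooth_cst R (- a))).
have sb := smooth_comp se
  (smoothD (@smooth_cst R b) (smoothM (@smooth_cst R (-1)) (@smooth_id R))).
exact (smoothM sa sb).
Qed.

Lemma cvg_expinv1 x : expinv n.+1%:R^-1 1 x @[n --> \oo] --> ((0 < x)%R%:R : R).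
Proof.
rewrite /expinv; have [x0|x0] := ltP 0 x; last exact: cvg_cst.
have -> : (fun n => (1 : {poly R}).[x^-1] * expR (- (n.+1%:R^-1 / x))) =
    (fun n => expR (- (harmonic n * x^-1))).
  by apply/funext => n; rewrite hornerC mul1r.
rewrite /= -[X in _ --> X](@expR0 R); apply: continuous_cvg.
  exact: continuous_expR.
rewrite -oppr0; apply: cvgN; rewrite -(mul0r x^-1).
by apply: cvgM; [exact: cvg_harmonic|exact: cvg_cst].
Qed.

Lemma cvg_bump a b x :
  smooth_bump n.+1%:R^-1 a b x @[n --> \oo] --> (\1_(`]a, b[%classic) x : R).
Proof.
rewrite indicE (_ : (x \in _) = (0 < x - a) && (0 < b - x)); last first.
  by rewrite mem_setE in_itv/= !subr_gt0.
rewrite -mulnb natrM.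
by apply: cvgM; exact: cvg_expinv1.
Qed.

End smooth_bump_theory.

(** * The lemma of du Bois-Reymond *)

Section du_bois_reymond.
Context {R : realType}.
Notation mu := (@lebesgue_measure R).
Implicit Types (a b c x : R) (f g h : R -> R).

Lemma locally_integrable_segment h a b : locally_integrable [set: R] h ->
  mu.-integrable `[a, b] (EFin \o h).
Proof.
move=> [mh _ hK]; apply/integrableP; split.
  by apply/measurable_EFinP; exact: measurable_funS mh.
by apply: hK => //; exact: segment_compact.
Qed.

(** Dominated convergence along the bumps with [c = 1/(n+1)]; the majorant is |h| restricted to
    [[a, b]], integrable because [h] is locally so. *)
Lemma Rintegral_itv_test0 h : locally_integrable [set: R] h ->
  (forall phi, test_function phi -> \int[mu]_x (h x * phi x) = 0) ->
  forall a b, \int[mu]_(x in `]a, b]) h x = 0.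
Proof.
move=> lh h0 a b; have ihab := locally_integrable_segment a b lh; have [mh _ _] := lh.
rewrite -Rintegral_itv_bndo_bndc; last first.
  by apply: integrableS ihab => //; exact: subset_itv_oo_cc.
rewrite Rintegral_mkcond.
pose f_ n x := h x * smooth_bump n.+1%:R^-1 a b x.
pose g := (Num.norm \o h) \_ `[a, b].
have tb n : test_function (smooth_bump n.+1%:R^-1 a b).
  by apply: test_bump; rewrite invr_gt0.
have mf_ n : measurable_fun [set: R] (EFin \o f_ n).
  apply/measurable_EFinP/measurable_funM => //.
  by apply: continuous_measurable_fun; exact: (smooth_continuous (n := 0) (tb n).1).
have ig : mu.-integrable [set: R] (EFin \o g).
  rewrite -restrict_EFin; apply/integrable_restrict => //; rewrite setTI.
  exact/integrable_norm/locally_integrable_segment.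
have fg n x : `|f_ n x| <= g x.
  rewrite /f_ /g patchE; have [xab|xab] := pselect (`]a, b[%classic x).
    rewrite mem_set; last exact: subset_itv_oo_cc.
    by rewrite normrM ler_piMr// bump_norm_le1// invr_gt0.
  rewrite bump_notin// mulr0 normr0; case: ifPn => // _; exact: normr_ge0.
have fcvg x : f_ n x @[n --> \oo] --> (h \_ `]a, b[) x.
  have -> : (h \_ `]a, b[) x = h x * \1_(`]a, b[%classic) x.
    by rewrite patchE indicE; case: ifPn; rewrite ?mulr1 ?mulr0.
  by apply: cvgM; [exact: cvg_cst|exact: cvg_bump].
have mlim : measurable_fun [set: R] (EFin \o h \_ `]a, b[).
  apply/measurable_EFinP/(measurable_restrictT _ _).1 => //.
  exact: measurable_funS mh.
have cvlim : {ae mu, forall x, [set: R] x ->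
    (EFin \o f_ n) x @[n --> \oo] --> (EFin \o h \_ `]a, b[) x}.
  by apply: aeW => x _; apply/fine_cvgP; split; [exact: nearW|exact: fcvg].
have dom : {ae mu, forall x n, [set: R] x ->
    (`|(EFin \o f_ n) x| <= (EFin \o g) x)%E}.
  by apply: aeW => x n _; rewrite lee_fin fg.
have [_ _ cv] := dominated_convergence (mu := mu) measurableT mf_ mlim cvlim ig dom.
suff s0 : [sequence (\int[mu]_x (EFin \o f_ n) x)%E]_n = cst 0%E.
  have := cvg_lim (@ereal_hausdorff R) cv.
  by rewrite s0 lim_cst// /Rintegral /= => <-.
apply/funext => n /=; have : mu.-integrable [set: R] (EFin \o f_ n).
  apply: (@le_integrable _ _ _ mu _ measurableT _ (EFin \o g)) => [|x _|//].
    exact: mf_.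
  by rewrite /= lee_fin (le_trans (fg _ _))// ler_norm.
move=> /integrable_fin_num => /(_ measurableT) /fineK <-.
by congr (_%:E); exact: (h0 _ (tb n)).
Qed.

(** The primitives of [h] vanish, hence so does their derivative, which is [h] almost everywhere by
    Lebesgue differentiation. As [h] is only locally integrable, the primitives start at -n, and
    countably many null sets are put together. *)
Lemma du_bois_reymond h : locally_integrable [set: R] h ->
  (forall phi, test_function phi -> \int[mu]_x (h x * phi x) = 0) ->
  {ae mu, forall x, h x = 0}.
Proof.
move=> lh h0; have hn (n : nat) : {ae mu, forall x, - n%:R < x -> h x = 0}.
  have ih y : mu.-integrable `](- n%:R), y] (EFin \o h).
    have := locally_integrable_segment (- n%:R) y lh; apply: integrableS => //.
    exact: subset_itv_oc_cc.
  have := FTC1 ih lh.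
  apply: filterS; first exact: (ae_filter_ringOfSetsType mu).
  move=> x /= dF nx.
  have {dF} [_ <-] := dF nx.
  rewrite (_ : (fun _ => _) = cst 0) ?derive1_cst//.
  by apply/funext => y; exact: Rintegral_itv_test0.
have := ae_foralln hn.
apply: filterS.
move=> x /(_ (Num.truncn `|x|).+1); apply.
rewrite ltrNl (le_lt_trans (ler_norm _))// normrN.
exact: real_truncnS_gt.
Qed.

End du_bois_reymond.

(** * Sobolev regularity of smooth functions *)

Section sobolev.
Context {R : realType}.
Notation mu := (@lebesgue_measure R).
Implicit Types (a b c x : R) (f g h phi : R -> R).

Lemma test_function_derive1 phi : test_function phi -> test_function phi^`().
Proof.
move=> [sphi cphi]; split; first exact: (smooth_derive1n (n := 1) sphi).
apply: subclosed_compact cphi _; first exact: closed_closure.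
apply: (@subset_trans _ (closure (closure [set x | phi x != 0]))); last first.
  by have /closure_id <- := @closed_closure _ [set x | phi x != 0].
apply: closure_subset => x /= phi'x; apply: contrapT => nx.
move/eqP: phi'x; apply; have : \forall y \near x, phi y = cst 0 y.
  have : open_nbhs x (~` closure [set x | phi x != 0]).
    by split=> //; apply: closed_openC; exact: closed_closure.
  move=> /open_nbhs_nbhs; apply: filterS => y ny.
  by apply/eqP/negP => /negP phiy; apply: ny; exact: subset_closure.
by move=> e; rewrite derive1E (near_eq_derive _ e) derive_cst.
Qed.

Lemma test_function_derive1n phi n : test_function phi ->
  test_function phi^`(n).
Proof.
by move=> tphi; elim: n => [//|n IH]; rewrite derive1nS; exact: test_function_derive1.
Qed.

Lemma test_function_support phi : test_function phi ->
  exists2 A, 0 < A & forall x, A <= `|x| -> phi x = 0.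
Proof.
move=> [_ /compact_bounded[M [_ MP]]]; exists (`|M| + 2).
  by rewrite ltr_wpDl.
move=> x Ax; apply: contrapT => /eqP phix.
have /= := MP (`|M| + 1) _ x (@subset_closure _ [set x | phi x != 0] x phix).
rewrite (le_lt_trans (ler_norm _))// ?ltrDl// => /(_ isT).
by rewrite leNgt (lt_le_trans _ Ax)// ltrD2l ltr1n.
Qed.

Lemma Rintegral_support f A : (forall x, A <= `|x| -> f x = 0) ->
  \int[mu]_x f x = \int[mu]_(x in `[- A, A]) f x.
Proof.
move=> f0; rewrite [RHS]Rintegral_mkcond; congr Rintegral.
apply/funext => x; rewrite patchE; case: ifPn => // xA.
apply: f0; rewrite leNgt; apply: contra xA => /ltW xA.
by rewrite mem_setE in_itv/= -ler_norml.
Qed.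

Lemma derivable_oo_LRcontinuousT f a b : (forall x, derivable f x 1) ->
  derivable_oo_LRcontinuous f a b.
Proof.
move=> df; split=> [x _//| |].
  by apply: cvg_at_right_filter; exact: derivable_continuous.
by apply: cvg_at_left_filter; exact: derivable_continuous.
Qed.

Lemma test_function_parts f phi : smooth f -> test_function phi ->
  \int[mu]_x (f x * phi^`()%classic x) = - \int[mu]_x (f^`()%classic x * phi x).
Proof.
move=> sf tphi; have [A A0 phi0] := test_function_support tphi.
have [B B0 phi'0] := test_function_support (test_function_derive1 tphi).
(* A common radius for [phi] and its derivative; [phi] vanishes at the endpoints -C and C as well,
   which kills the boundary terms. *)
pose C := Num.max A B.
have phiC x : C <= `|x| -> phi x = 0.
  by move=> Cx; apply: phi0; rewrite (le_trans _ Cx)// le_max lexx.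
have phi'C x : C <= `|x| -> phi^`()%classic x = 0.
  by move=> Cx; apply: phi'0; rewrite (le_trans _ Cx)// le_max lexx orbT.
have C0 : 0 < C by rewrite lt_max A0.
rewrite !(@Rintegral_support _ C); last 2 first.
- by move=> x /phiC ->; rewrite mulr0.
- by move=> x /phi'C ->; rewrite mulr0.
rewrite (@Rintegration_by_parts _ _ phi f^`() phi^`()); first last.
- by [].
- by apply: derivable_oo_LRcontinuousT => x; exact: (tphi.1 0%N).
- by apply: continuous_subspaceT; exact: (smooth_continuous (n := 1) tphi.1).
- by [].
- by apply: derivable_oo_LRcontinuousT => x; exact: (sf 0%N).
- by apply: continuous_subspaceT; exact: (smooth_continuous (n := 1) sf).
- by rewrite (lt_trans _ C0)// oppr_lt0.
by rewrite !phiC ?normrN ?ger0_norm ?(ltW C0)// !mulr0 subr0 sub0r.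
Qed.

Lemma weak_derivative_smooth f i : smooth f -> weak_derivative i f f^`(i).
Proof.
elim: i f => [|i IH] f sf phi tphi; first by rewrite expr0 mul1r.
rewrite derive1nS test_function_parts//; last exact: test_function_derive1n.
rewrite IH//; last exact: (smooth_derive1n (n := 1) sf).
by rewrite derive1Sn exprS mulN1r mulNr.
Qed.

Lemma sobolev1_infty_smooth f : smooth f -> (forall n, L1 f^`(n)) ->
  sobolev1_infty f.
Proof.
move=> sf Lf k; split; first exact: (Lf 0%N).
by move=> i _; exists f^`(i); [exact: Lf|exact: weak_derivative_smooth].
Qed.

Lemma continuous_locally_integrable f : continuous f ->
  locally_integrable [set: R] f.
Proof.
move=> cf; split.
- exact: continuous_measurable_fun.
- exact: openT.
move=> K _ cK; have : mu.-integrable K (EFin \o f).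
  by apply: continuous_compact_integrable => //; exact: continuous_subspaceT.
by move=> /integrableP[].
Qed.

Lemma integrable_test f phi : locally_integrable [set: R] f ->
  test_function phi -> mu.-integrable [set: R] (EFin \o (fun x => f x * phi x)).
Proof.
move=> lf tphi; have [A A0 phi0] := test_function_support tphi.
have cphi : continuous phi := smooth_continuous (n := 0) tphi.1.
have -> : EFin \o (fun x => f x * phi x) =
    (EFin \o (fun x => f x * phi x)) \_ `[- A, A].
  apply/funext => x; rewrite patchE; case: ifPn => // xA /=.
  rewrite phi0 ?mulr0// leNgt; apply: contra xA => /ltW xA.
  by rewrite mem_setE in_itv/= -ler_norml.
apply/(integrable_mkcond _ _).1 => //.
apply: (@integrableMl _ _ _ mu `[- A, A] _ (EFin \o f) phi) => //.
- exact: locally_integrable_segment.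
- exact: measurable_funTS (continuous_measurable_fun cphi).
have := compact_bounded (continuous_compact (continuous_subspaceT cphi)
  (@segment_compact _ (- A) A)).
move=> [M [Mr MP]]; exists M; split=> // M' MM' x xA.
by apply: MP MM' _ _; exists x.
Qed.

(** The classical derivative and the integrable weak one have the same integrals against test
    functions, so they agree almost everywhere and integrability is transferred. *)
Lemma sobolev1_infty_L1 f n : smooth f -> sobolev1_infty f -> L1 f^`(n).
Proof.
move=> sf /(_ n)[_ /(_ n (leqnn n))[g Lg wg]].
have cfn := smooth_continuous (n := n) sf.
have lfn := continuous_locally_integrable cfn.
have lg : locally_integrable [set: R] g.
  by apply: open_integrable_locally => //; exact: openT.
have : {ae mu, forall x, (f^`(n)%classic \- g) x = 0}.
  apply: du_bois_reymond; first exact: locally_integrableB.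
  move=> phi tphi; under eq_Rintegral do rewrite /= mulrBl.
  rewrite RintegralB//; [|exact: integrable_test..].
  apply/eqP; rewrite subr_eq0; apply/eqP.
  have /(mulrI (unitrX n (@unitrN1 R))) // :
      (-1) ^+ n * \int[mu]_x (f^`(n)%classic x * phi x) =
      (-1) ^+ n * \int[mu]_x (g x * phi x).
  by rewrite -weak_derivative_smooth// wg.
move=> fg; apply/integrableP; split.
  by apply/measurable_EFinP; exact: continuous_measurable_fun.
move/integrableP : Lg => [mg].
rewrite (@ae_eq_integral _ _ _ mu _ (abse \o (EFin \o g))
  (abse \o (EFin \o f^`(n)))) //.
- apply: measurableT_comp => //; apply/measurable_EFinP.
  exact: continuous_measurable_fun.
- exact: measurableT_comp.
apply: filterS fg; first exact: (ae_filter_ringOfSetsType mu).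
move=> x /= /eqP; rewrite subr_eq0 => /eqP -> //.
Qed.

End sobolev.

(** * Smooth functions with integrable derivatives *)

Section integrable_derivatives.
Context {R : realType}.
Notation mu := (@lebesgue_measure R).
Implicit Types (a b c x l : R) (f g h v : R -> R).

Lemma L1_itv f (i : interval R) : L1 f -> mu.-integrable [set` i] (EFin \o f).
Proof. by move=> Lf; apply: integrableS Lf => //; exact: measurable_itv. Qed.

Lemma cvg_Rintegral_itv f g (u : nat -> R) : L1 f ->
  (forall x, (f \_ `]-oo, u n]) x @[n --> \oo] --> g x) ->
  (\int[mu]_(x in `]-oo, u n]) f x) @[n --> \oo] --> \int[mu]_x g x.
Proof.
move=> Lf fg; have mf : measurable_fun [set: R] f.
  by apply/measurable_EFinP; exact: measurable_int Lf.
pose f_ n := EFin \o (f \_ `]-oo, u n]).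
have mf_ n : measurable_fun [set: R] (f_ n).
  apply/measurable_EFinP/(measurable_restrictT _ _).1 => //.
  exact: measurable_funS mf.
have cvlim : {ae mu, forall x, [set: R] x -> f_ ^~ x @ \oo --> (EFin \o g) x}.
  by apply: aeW => x _; apply/fine_cvgP; split; [exact: nearW|exact: fg].
have mg : measurable_fun [set: R] (EFin \o g).
  apply: (emeasurable_fun_cvg _ _ mf_) => x _.
  by apply/fine_cvgP; split; [exact: nearW|exact: fg].
have dom : {ae mu, forall x n, [set: R] x ->
    (`|f_ n x| <= (EFin \o (Num.norm \o f)) x)%E}.
  apply: aeW => x n _; rewrite lee_fin patchE.
  by case: ifPn => // _; rewrite normr0 /= normr_ge0.
have Lnf : mu.-integrable [set: R] (EFin \o (Num.norm \o f)).
  exact: integrable_norm.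
have [ig _ cv] := dominated_convergence (mu := mu) measurableT mf_ mg cvlim Lnf dom.
have : (fine \o (fun n => \int[mu]_x f_ n x)%E) n @[n --> \oo] -->
    \int[mu]_x g x.
  by apply: fine_cvg; rewrite /Rintegral fineK; [exact: cv|exact: integrable_fin_num].
apply: cvg_trans; apply: near_eq_cvg; apply: nearW => n.
by rewrite /= Rintegral_mkcond.
Qed.

Lemma cvg_RintegralNy f : L1 f ->
  \int[mu]_(y in `]-oo, x]) f y @[x --> -oo] --> (0 : R).
Proof.
move=> Lf; apply/cvg_ninftyP => u uNy.
have -> : (0 : R) = \int[mu]_x (cst 0 x) by rewrite /Rintegral integral0.
apply: cvg_Rintegral_itv => // x; apply: cvg_near_cst.
have : \forall n \near \oo, u n < x by move/cvgrNyPlt : uNy; exact.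
apply: filterS => n unx; rewrite patchE ifN// mem_setE in_itv/= -ltNge//.
Qed.

Lemma cvg_Rintegraly f : L1 f ->
  \int[mu]_(y in `]-oo, x]) f y @[x --> +oo] --> \int[mu]_y f y.
Proof.
move=> Lf; apply/cvg_pinftyP => u uy.
apply: cvg_Rintegral_itv => // x; apply: cvg_near_cst.
have : \forall n \near \oo, x <= u n by move/cvgryPge : uy; exact.
by apply: filterS => n unx; rewrite patchE ifT// mem_setE in_itv/=.
Qed.

Lemma L1_unbounded_itv f (i : interval R) e : 0 < e -> L1 f ->
  mu [set` i] = +oo%E -> (forall x, x \in i -> e <= `|f x|) -> False.
Proof.
move=> e0 Lf ioo h; have mi : measurable [set` i] := measurable_itv i.
have Lnf : L1 (Num.norm \o f) by exact: integrable_norm.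
have := integrable_fin_num (mu := mu) (measurable_itv i) (L1_itv i Lnf).
suff -> : (\int[mu]_(x in [set` i]) (EFin \o (Num.norm \o f)) x = +oo)%E by [].
apply/eqP; rewrite -leye_eq.
have <- : ((\int[mu]_(x in [set` i]) (cst e%:E x)) = +oo)%E.
  rewrite integral_cst//.
  by rewrite [X in (_ * X)%E]ioo gt0_muley.
apply: ge0_le_integral => //=.
- by move=> x _; rewrite lee_fin ltW.
- by apply: measurable_int; exact: (L1_itv i Lnf).
Qed.

(** Otherwise |f| would be at least |l|/2 on a half-line, which has infinite measure. *)
Lemma L1_cvgNy0 f l : L1 f -> f x @[x --> -oo] --> l -> l = 0.
Proof.
move=> Lf fl; apply/eqP; rewrite -normr_le0 leNgt; apply/negP => l0.
have [A AP] : exists A, forall x, x < A -> `|l| / 2 <= `|f x|.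
  have l20 : 0 < `|l| / 2 by rewrite divr_gt0.
  move/cvgrPdist_lt : fl => /(_ _ l20)[A [_ AP]]; exists A => x /AP /= lfx.
  have := ler_normD (l - f x) (f x); rewrite subrK.
  lra.
have l20 : 0 < `|l| / 2 by rewrite divr_gt0.
apply: (@L1_unbounded_itv f `]-oo, A[%O _ l20 Lf).
- by rewrite lebesgue_measure_itv/= ltNyr.
- by move=> x; rewrite in_itv/=; exact: AP.
Qed.

Lemma L1_cvgy0 f l : L1 f -> f x @[x --> +oo] --> l -> l = 0.
Proof.
move=> Lf fl; apply/eqP; rewrite -normr_le0 leNgt; apply/negP => l0.
have [A AP] : exists A, forall x, A < x -> `|l| / 2 <= `|f x|.
  have l20 : 0 < `|l| / 2 by rewrite divr_gt0.
  move/cvgrPdist_lt : fl => /(_ _ l20)[A [_ AP]]; exists A => x /AP /= lfx.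
  have := ler_normD (l - f x) (f x); rewrite subrK.
  lra.
have l20 : 0 < `|l| / 2 by rewrite divr_gt0.
apply: (@L1_unbounded_itv f `]A, +oo[%O _ l20 Lf).
- by rewrite lebesgue_measure_itv/= ltry.
- by move=> x; rewrite in_itv/= andbT; exact: AP.
Qed.

Lemma is_derive_RintegralNy f x : L1 f -> {for x, continuous f} ->
  is_derive x 1 (fun y => \int[mu]_(z in `]-oo, y]) f z) (f x).
Proof.
move=> Lf cf; have x1 : x < x + 1 by rewrite ltrDl.
have ax : (-oo%O < BRight x)%E by rewrite ltNyr.
have [dF <-] := continuous_FTC1 x1 (L1_itv `]-oo, x + 1]%O Lf) ax cf.
exact: is_derive_derive1.
Qed.

(** The difference between [f] and the primitive of its derivative from -oo has zero derivative. The
    decomposition yields boundedness at once and, when [f] itself is integrable, the limits 0 at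
    both ends. *)
Lemma L1_derive1 f : (forall x, derivable f x 1) -> continuous f^`() ->
  L1 f^`() ->
  exists c (F : R -> R) l, [/\ f = cst c + F, F x @[x --> -oo] --> (0 : R),
    F x @[x --> +oo] --> l & exists M, forall x, `|F x| <= M].
Proof.
move=> df cf' Lf'; pose F x := \int[mu]_(y in `]-oo, x]) f^`()%classic y.
exists (f 0 - F 0), F, (\int[mu]_y f^`()%classic y); split.
- apply/funext => x; suff : (f - F) x = (f - F) 0.
    by move=> /(congr1 (+%R^~ (F x))); rewrite /= subrK.
  apply: is_derive_0_is_cst => y; rewrite -(subrr (f^`()%classic y)).
  apply: is_deriveB; first exact: is_derive_derive1.
  exact: (is_derive_RintegralNy Lf' (cf' y)).
- exact: cvg_RintegralNy.
- exact: cvg_Rintegraly.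
exists (\int[mu]_y `|f^`()%classic y|) => x.
have := le_normr_Rintegral (mu := mu) (measurable_itv _) (L1_itv `]-oo, x]%O Lf').
move=> /le_trans; apply.
have Lnf : L1 (Num.norm \o f^`()) by exact: integrable_norm.
rewrite /Rintegral fine_le//.
- by apply: integrable_fin_num => //; exact: (L1_itv `]-oo, x]%O Lnf).
- exact: integrable_fin_num.
apply: ge0_subset_integral => //=; first exact: measurable_int Lnf.
Qed.

Lemma L1_derive1_bounded f : (forall x, derivable f x 1) -> continuous f^`() ->
  L1 f^`() -> exists M, forall x, `|f x| <= M.
Proof.
move=> df cf' /(L1_derive1 df cf')[c [F [l [-> _ _ [M FM]]]]].
exists (`|c| + M) => x.
by rewrite (le_trans (ler_normD _ _))// lerD2l.
Qed.

Lemma L1_derive1_cvgNy f : (forall x, derivable f x 1) -> continuous f^`() ->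
  L1 f -> L1 f^`() -> f x @[x --> -oo] --> (0 : R).
Proof.
move=> df cf' Lf /(L1_derive1 df cf')[c [F [l [fE FNy _ _]]]].
suff fc : f x @[x --> -oo] --> c by rewrite -[X in _ --> X](L1_cvgNy0 Lf fc).
by rewrite fE -[X in _ --> X]addr0; apply: cvgD; [exact: cvg_cst|exact: FNy].
Qed.

Lemma L1_derive1_cvgy f : (forall x, derivable f x 1) -> continuous f^`() ->
  L1 f -> L1 f^`() -> f x @[x --> +oo] --> (0 : R).
Proof.
move=> df cf' Lf /(L1_derive1 df cf')[c [F [l [fE _ Fy _]]]].
suff fc : f x @[x --> +oo] --> c + l by rewrite -[X in _ --> X](L1_cvgy0 Lf fc).
by rewrite fE; apply: cvgD; [exact: cvg_cst|exact: Fy].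
Qed.

Definition bounded_continuous f :=
  continuous f /\ exists M, forall x, `|f x| <= M.

(** Boundedness is kept along with integrability because the derivatives of [u0'] play two parts:
    integrable functions, and multipliers in the derivatives of [inverse_jacobian]. *)
Definition bounded_L1 f := bounded_continuous f /\ L1 f.

Lemma bounded_continuousD f g : bounded_continuous f -> bounded_continuous g ->
  bounded_continuous (f + g).
Proof.
move=> [cf [M fM]] [cg [N gN]]; split.
  by move=> x; exact: continuousD (cf x) (cg x).
by exists (M + N) => x; rewrite (le_trans (ler_normD _ _))// lerD.
Qed.

Lemma bounded_continuousM f g : bounded_continuous f -> bounded_continuous g ->
  bounded_continuous (f * g).
Proof.
move=> [cf [M fM]] [cg [N gN]]; split.
  by move=> x; exact: continuousM (cf x) (cg x).
by exists (M * N) => x; rewrite normrM ler_pM.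
Qed.

Lemma bounded_L1D f g : bounded_L1 f -> bounded_L1 g -> bounded_L1 (f + g).
Proof.
move=> [bf Lf] [bg Lg]; split; first exact: bounded_continuousD.
exact: (integrableD measurableT Lf Lg).
Qed.

Lemma bounded_L1M f g : bounded_L1 f -> bounded_continuous g ->
  bounded_L1 (f * g).
Proof.
move=> [bf Lf] bg; split; first exact: bounded_continuousM.
have [cg [M gM]] := bg; apply: (@integrableMl _ _ _ mu setT _ (EFin \o f) g) => //.
- exact: continuous_measurable_fun.
- by exists M; split; [exact: num_real|]=> N /ltW MN x _; exact: le_trans MN.
Qed.

(** Each derivative is bounded because the next one is integrable. *)
Lemma derivs_bounded_L1 v : smooth v -> (forall n, L1 v^`(n)) ->
  forall n, derivs bounded_L1 n v.
Proof.
move=> sv Lv; apply/derivsP; split=> // n; split; last exact: Lv.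
split; first exact: smooth_continuous.
apply: L1_derive1_bounded; first exact: (sv n).
- by rewrite -derive1nS; exact: smooth_continuous.
- by rewrite -derive1nS; exact: Lv.
Qed.

End integrable_derivatives.

(** * Calculus in two variables *)

Lemma inverseK (R : realType) (f : R -> R) : bijective f ->
  cancel f (inverse f) /\ cancel (inverse f) f.
Proof.
move=> [g fK gK]; split=> x.
  by apply: pinvKV; rewrite ?in_setT// => y z _ _; exact: (can_inj fK).
by apply: pinvK; rewrite inE /=; exists (g x).
Qed.

Section two_variables.
Context {R : realType}.
Implicit Types (F G : R -> R -> R) (f psi : R -> R) (t x y : R).

Definition joint F : R * R -> R := fun p => F p.1 p.2.

Lemma joint_continuousP F t x :
  {for (t, x), continuous (joint F)} <->
  forall e, 0 < e -> exists2 d, 0 < d & forall s y,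
    `|s - t| < d -> `|y - x| < d -> `|F s y - F t x| < e.
Proof.
split=> [cF e e0|h].
  have /cvgrPdist_lt/(_ e e0)/nbhs_ballP[d d0 dP] := cF.
  exists d => // s y st yx; rewrite distrC; apply: (dP (s, y)).
  by split; rewrite /ball/= distrC.
apply/cvgrPdist_lt => e /h[d d0 dP].
apply: filterS (nbhsx_ballx (t, x) d d0) => -[s y] [/=].
rewrite /ball/= distrC => st; rewrite distrC => yx.
by rewrite distrC; exact: dP.
Qed.

Lemma continuous_eps f x : {for x, continuous f} ->
  forall e, 0 < e -> exists2 d, 0 < d & forall y, `|y - x| < d -> `|f y - f x| < e.
Proof.
move=> /cvgrPdist_lt fx e /fx /nbhs_ballP[d d0 dP]; exists d => // y yx.
by rewrite distrC; apply: dP; rewrite /ball/= distrC.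
Qed.

Lemma eps_continuous f x :
  (forall e, 0 < e -> exists2 d, 0 < d & forall y, `|y - x| < d -> `|f y - f x| < e) ->
  {for x, continuous f}.
Proof.
move=> h; apply/cvgrPdist_lt => e /h[d d0 dP]; apply/nbhs_ballP; exists d => //.
by move=> y; rewrite /ball/= distrC => /dP; rewrite distrC.
Qed.

(** Locating the intermediate point by its distance to [a] avoids ordering [a] and [b], and is the
    form in which closeness is used afterwards. *)
Lemma MVT_between f a b :
  (forall z, `|z - a| <= `|b - a| -> derivable f z 1) ->
  exists2 c, `|c - a| <= `|b - a| & f b - f a = f^`()%classic c * (b - a).
Proof.
move=> df; have id z : `|z - a| <= `|b - a| -> is_derive z 1 f (f^`()%classic z).
  by move=> /df /is_derive_derive1.
have cf z : `|z - a| <= `|b - a| -> {for z, continuous f}.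
  by move=> /df /derivable_continuous.
have [ab|ba] := leP a b.
  have zab z : z \in `[a, b]%R -> `|z - a| <= `|b - a|.
    by rewrite in_itv/= => /andP[az zb]; rewrite !ger0_norm ?subr_ge0// lerB.
  have [||c cab ->] := @MVT_segment R f f^`() a b ab.
  - by move=> z /subset_itv_oo_cc /zab /id.
  - by apply: continuous_in_subspaceT => z; rewrite inE/= => /zab /cf.
  by exists c => //; exact: zab.
have zab z : z \in `[b, a]%R -> `|z - a| <= `|b - a|.
  rewrite in_itv/= => /andP[bz za]; rewrite ![`|_ - a|]distrC.
  by rewrite !ger0_norm ?subr_ge0// ?lerB// ltW.
have [||c cab fE] := @MVT_segment R f f^`() b a (ltW ba).
- by move=> z /subset_itv_oo_cc /zab /id.
- by apply: continuous_in_subspaceT => z; rewrite inE/= => /zab /cf.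
by exists c; [exact: zab|rewrite -opprB fE -mulrN opprB].
Qed.

Lemma open_eps (J : set R) t : open J -> J t ->
  exists2 d, 0 < d & forall s, `|s - t| < d -> J s.
Proof.
move=> oJ Jt; have /nbhs_ballP[d d0 dJ] := open_nbhs_nbhs (conj oJ Jt).
by exists d => // s st; apply: dJ; rewrite /ball/= distrC.
Qed.

(** At each [s] the mean value theorem in [x] gives an intermediate point, squeezed towards [psi t]
    by continuity of [psi]; joint continuity of [dx F] makes the slope continuous. Multiplied by a
    slope of [psi] it gives the chain rule; solved for [psi s - psi t] it gives the derivative of an
    implicit function. *)
Lemma partial_slope (J : set R) F psi t : open J -> J t ->
  (forall s y, J s -> derivable (F s) y 1) ->
  {for (t, psi t), continuous (joint (dx F))} ->
  {for t, continuous psi} ->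
  exists q : R -> R,
    [/\ forall s, J s -> F s (psi s) - F s (psi t) = q s * (psi s - psi t),
        {for t, continuous q} & q t = dx F t (psi t)].
Proof.
move=> oJ Jt dF /joint_continuousP cF cpsi.
have /choice[c cP] s : exists c, J s -> `|c - psi t| <= `|psi s - psi t| /\
    F s (psi s) - F s (psi t) = dx F s c * (psi s - psi t).
  have [Js|nJs] := pselect (J s); last by exists 0.
  have [|c c1 c2] := @MVT_between (F s) (psi t) (psi s).
    by move=> *; exact: dF.
  by exists c.
(* At [s = t] the slope equation reads 0 = 0; it is the distance bound that fixes [c t]. *)
have ct : c t = psi t.
  by have [+ _] := cP t Jt; rewrite subrr normr0 normr_le0 subr_eq0 => /eqP.
exists (fun s => dx F s (c s)); split; [by move=> s /cP[]| |by rewrite ct].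
apply: eps_continuous => e e0; rewrite ct.
have [d d0 dP] := cF e e0.
have [d1 d10 d1P] := continuous_eps cpsi d0.
have [d2 d20 d2P] := open_eps oJ Jt.
exists (Num.min d (Num.min d1 d2)); first by rewrite !lt_min d0 d10.
move=> s; rewrite !lt_min => /and3P[sd sd1 sd2]; apply: dP => //.
have [h _] := cP s (d2P _ sd2).
exact: le_lt_trans h (d1P _ sd1).
Qed.

Lemma chain_rule (J : set R) F psi t a b : open J -> J t ->
  (forall s y, J s -> derivable (F s) y 1) ->
  {for (t, psi t), continuous (joint (dx F))} ->
  is_derive t 1 (F ^~ (psi t)) a -> is_derive t 1 psi b ->
  is_derive t 1 (fun s => F s (psi s)) (a + dx F t (psi t) * b).
Proof.
move=> oJ Jt dF cF /is_derive1_caratheodory[r [rE cr rt]].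
move=> dpsi; have cpsi : {for t, continuous psi}.
  by apply: derivable_continuous; case: dpsi.
move: dpsi => /is_derive1_caratheodory[p [pE cp pt]].
have [q [qE cq qt]] := partial_slope oJ Jt dF cF cpsi.
apply: (@near_eq_is_derive _ R R (fun s => F t (psi t) + (r s + q s * p s) * (s - t))).
  have [d d0 dP] := open_eps oJ Jt.
  near=> s; have Js : J s.
    by apply: dP; rewrite distrC; near: s; exact: (nbhsx_ballx t d d0).
  have := qE _ Js; have := rE s; rewrite /= pE => h1 h2.
  by rewrite mulrDl -h1 -mulrA -h2; ring.
apply/is_derive1_caratheodory; exists (fun s => r s + q s * p s); split.
- by move=> z; rewrite subrr mulr0 addr0 addrC addKr.
- by apply: cvgD; [exact: cr|apply: cvgM; [exact: cq|exact: cp]].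
- by rewrite rt qt pt.
Unshelve. all: by end_near. Qed.

(** Differentiability of [psi] is a conclusion: constancy of [F s (psi s)] reads
    [- r s * (s - t) = q s * (psi s - psi t)], with [r] and [q] the slopes in the two variables, and
    [q] does not vanish near [t]. *)
Lemma implicit_derive (J : set R) F psi t x a : open J -> J t ->
  (forall s y, J s -> derivable (F s) y 1) ->
  {for (t, psi t), continuous (joint (dx F))} ->
  {for t, continuous psi} -> (forall s, J s -> F s (psi s) = x) ->
  is_derive t 1 (F ^~ (psi t)) a -> dx F t (psi t) != 0 ->
  is_derive t 1 psi (- a / dx F t (psi t)).
Proof.
move=> oJ Jt dF cF cpsi Fpsi /is_derive1_caratheodory[r [rE cr rt]] F'0.
have [q [qE cq qt]] := partial_slope oJ Jt dF cF cpsi.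
apply: (@near_eq_is_derive _ R R (fun s => psi t + (- r s / q s) * (s - t))).
  have [d d0 dP] := open_eps oJ Jt.
  have [|d1 d10 d1P] := @continuous_eps q t cq `|q t|; first by rewrite normr_gt0 qt.
  near=> s.
  have [sd sd1] : `|s - t| < d /\ `|s - t| < d1.
    by split; rewrite distrC; near: s; exact: nbhsx_ballx.
  have Js := dP _ sd; have qs : q s != 0.
    apply/eqP => qs0; have := d1P _ sd1.
    by rewrite qs0 sub0r normrN ltxx.
  have := qE _ Js; have := rE s; rewrite /= !Fpsi// => h1 h2.
  have h3 : - r s * (s - t) = q s * (psi s - psi t).
    by rewrite -h2 mulNr -h1; ring.
  by rewrite mulrAC h3 [q s * _]mulrC mulfK// addrC subrK.
apply/is_derive1_caratheodory; exists (fun s => - r s / q s); split.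
- by move=> z; rewrite subrr mulr0 addr0 addrC addKr.
- apply: cvgM; first by apply: cvgN; exact: cr.
  by apply: cvgV; [rewrite qt|exact: cq].
- by rewrite rt qt.
Unshelve. all: by end_near. Qed.

(** By strict monotonicity, [F t] takes values on either side of [x] at [y - e/2] and [y + e/2].
    This is an open condition on [(t, x)], and the intermediate value theorem then places [psi s z]
    between the same two points. *)
Lemma inverse_continuous (J : set R) F (psi : R -> R -> R) t x : open J -> J t ->
  (forall s y, J s -> {for (s, y), continuous (joint F)}) ->
  (forall s, J s -> continuous (F s)) ->
  (forall s, J s -> cancel (F s) (psi s) /\ cancel (psi s) (F s)) ->
  {for (t, x), continuous (joint psi)}.
Proof.
move=> oJ Jt jF cF FK; apply/joint_continuousP => e e0.
set y := psi t x; pose e2 := e / 2; have e20 : 0 < e2 by rewrite divr_gt0.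
have e2e : e2 < e by rewrite /e2; lra.
have Ft : F t y = x by have [_] := FK t Jt; exact.
(* A negative product covers increasing and decreasing [F t] together. *)
have sgn : (F t (y - e2) - x) * (F t (y + e2) - x) < 0.
  have inj : {in `]-oo, +oo[%R &, injective (F t)}.
    by move=> u v _ _; have [FtK _] := FK t Jt; exact: (can_inj FtK).
  have yl : y - e2 < y by rewrite ltrBlDr ltrDl.
  have yr : y < y + e2 by rewrite ltrDl.
  have cFt : {within [set` `]-oo, +oo[%O], continuous (F t)}.
    exact/continuous_subspaceT/cF.
  have [mono|mono] := itv_continuous_inj_mono cFt inj.
    rewrite nmulr_rlt0; last by rewrite subr_lt0 -[ltRHS]Ft mono// in_itv.
    by rewrite subr_gt0 -[ltLHS]Ft mono// in_itv.
  rewrite pmulr_rlt0; last by rewrite subr_gt0 -[ltLHS]Ft mono// in_itv.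
  by rewrite subr_lt0 -[ltRHS]Ft mono// in_itv.
have : \forall p \near (t, x), (F p.1 (y - e2) - p.2) * (F p.1 (y + e2) - p.2) < 0.
  pose H (p : R * R) := (F p.1 (y - e2) - p.2) * (F p.1 (y + e2) - p.2).
  have cFl z : {for (t, x), continuous (fun p : R * R => F p.1 z)}.
    have /joint_continuousP cz := jF t z Jt.
    apply: (joint_continuousP (fun s _ => F s z) t x).2 => e' /cz[d d0 dP].
    by exists d => // s u st _; apply: dP; rewrite ?subrr ?normr0.
  have : H p @[p --> (t, x)] --> H (t, x).
    apply: cvgM; apply: cvgB; try exact: cFl; exact: cvg_snd.
  by move=> /cvgr_lt; apply.
move=> /nbhs_ballP[d d0 dP].
have [d1 d10 d1P] := open_eps oJ Jt.
exists (Num.min d d1); first by rewrite lt_min d0.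
move=> s z; rewrite !lt_min => /andP[sd sd1] /andP[zd _].
have Js := d1P _ sd1.
have {dP sgn} /= sgn : (F s (y - e2) - z) * (F s (y + e2) - z) < 0.
  by apply: (dP (s, z)); split; rewrite /ball/= distrC.
have [|||c] := @IVT R (F s) (y - e2) (y + e2) z.
- by rewrite lerBlDr -addrA lerDl addr_ge0// ltW.
- exact/continuous_subspaceT/cF.
- rewrite ge_min le_max.
  move: sgn; have [h|h] := ltP (F s (y - e2)) z.
    rewrite nmulr_rlt0 ?subr_lt0// subr_gt0 => /ltW ->; rewrite ltW//= orbT//.
  have [h'|h'] := ltP (F s (y + e2)) z; first by rewrite (ltW h') orbT.
  by rewrite ltNge mulr_ge0// subr_ge0.
rewrite in_itv/= => /andP[c1 c2] Fc.
have -> : psi s z = c by rewrite -Fc; have [+ _] := FK s Js; exact.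
rewrite (@le_lt_trans _ _ e2)// ler_norml; apply/andP; split; lra.
Qed.

(** The second difference of [F] over a square of side [h] is evaluated by two mean value theorems
    in each of the two orders. The mixed derivatives thus coincide at two points close to [(t, x)],
    and their continuity concludes. *)
Lemma schwarz (J : set R) F t x : open J -> J t -> smooth_on J F ->
  dt (dx F) t x = dx (dt F) t x.
Proof.
have alg (a b c d u v h : R) : h != 0 -> a - b - (c - d) = u * h * h ->
    a - c - (b - d) = v * h * h -> u = v.
  move=> h0 u2 v2; apply: (mulIf h0); apply: (mulIf h0).
  by rewrite -u2 -v2; ring.
have tri (u v w e : R) : `|v - u| < e / 2 -> `|v - w| < e / 2 -> `|u - w| <= e.
  by rewrite distrC => h1 h2; have := ler_distD v u w; lra.
move=> oJ Jt sF; apply/eqP; rewrite -subr_eq0 -normr_le0; apply/ler_addgt0Pr => e e0.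
rewrite add0r.
have /joint_continuousP c1 : {for (t, x), continuous (joint (dt (dx F)))}.
  by have [] := sF [:: true; false] t x Jt.
have /joint_continuousP c2 : {for (t, x), continuous (joint (dx (dt F)))}.
  by have [] := sF [:: false; true] t x Jt.
have e20 : 0 < e / 2 by rewrite divr_gt0.
have [d1 d10 d1P] := c1 _ e20; have [d2 d20 d2P] := c2 _ e20.
have [d3 d30 d3P] := open_eps oJ Jt.
(* Small enough for the closed square to stay over [J] and within both continuity radii. *)
pose h := Num.min d1 (Num.min d2 d3) / 2.
have m0 : 0 < Num.min d1 (Num.min d2 d3) by rewrite !lt_min d10 d20.
have h0 : 0 < h by rewrite divr_gt0.
have hm : h < Num.min d1 (Num.min d2 d3) by rewrite /h; lra.
have /and3P[hd1 hd2 hd3] : [&& h < d1, h < d2 & h < d3].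
  by move: hm; rewrite !lt_min.
have hh y : y + h - y = h by rewrite addrC addKr.
have nh : `|h| = h by rewrite gtr0_norm.
have Jh s : `|s - t| <= h -> J s by move=> /le_lt_trans sh; exact/d3P/sh.
have dxF s z : J s -> derivable (F s) z 1.
  by move=> Js; have [_ + _] := sF [::] s z Js.
have dtF s z : J s -> derivable (F^~ z) s 1.
  by move=> Js; have [+ _ _] := sF [::] s z Js.
have [|c ch cE] := @MVT_between (fun z => F (t + h) z - F t z) x (x + h).
  move=> z _; apply: derivableB; apply: dxF => //.
  by apply: Jh; rewrite hh nh.
have [|s sh sE] := @MVT_between (dx F ^~ c) t (t + h).
  rewrite hh nh => z /Jh Jz.
  by have [+ _ _] := sF [:: false] z c Jz.
have [|s' sh' sE'] := @MVT_between (fun s => F s (x + h) - F s x) t (t + h).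
  rewrite hh nh => z /Jh Jz; apply: derivableB; exact: dtF.
have Js' : J s' by apply: Jh; rewrite -[h in _ <= h]nh -(hh t).
have [|c' ch' cE'] := @MVT_between (dt F s') x (x + h).
  by move=> z _; have [_ + _] := sF [:: true] s' z Js'.
move: cE sE sE' cE'; rewrite !hh.
rewrite (_ : (fun z => F (t + h) z - F t z)^`()%classic c =
    dx F (t + h) c - dx F t c); last first.
  apply: derive1_is_derive; apply: is_deriveB; apply: is_derive_derive1.
    by apply: dxF; apply: Jh; rewrite hh nh.
  exact: dxF.
rewrite (_ : (fun s => F s (x + h) - F s x)^`()%classic s' =
    dt F s' (x + h) - dt F s' x); last first.
  by apply: derive1_is_derive; apply: is_deriveB; apply: is_derive_derive1; exact: dtF.
move=> cE sE sE' cE'; rewrite sE in cE; rewrite cE' in sE'.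
have key : dt (dx F) s c = dx (dt F) s' c' :=
  alg _ _ _ _ _ _ _ (lt0r_neq0 h0) cE sE'.
rewrite !hh !nh in ch sh ch' sh'.
have h1 := d1P s c (le_lt_trans sh hd1) (le_lt_trans ch hd1).
have h2 := d2P s' c' (le_lt_trans sh' hd2) (le_lt_trans ch' hd2).
by rewrite key in h1; exact: tri h1 h2.
Qed.

End two_variables.

(** * Finite-order regularity in two variables *)

Fixpoint joint_derivs (R : realType) (k : nat) (F : R -> R -> R) : Prop :=
  [/\ forall t x, derivable (F^~ x) t 1, forall t x, derivable (F t) x 1,
      continuous (joint F)
    & if k is l.+1 then joint_derivs l (dt F) /\ joint_derivs l (dx F) else True].

Section joint_derivs.
Context {R : realType}.
Implicit Types (F G H : R -> R -> R) (f : R -> R) (t x : R).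

(** [joint_derivs] peels off the innermost derivative, which is the last letter of a word; hence the
    induction on words from their right end. *)
Lemma joint_derivs_smooth F : (forall k, joint_derivs k F) <-> smooth_on [set: R] F.
Proof.
split=> [hF w|sF k].
  suff h k : joint_derivs k (partial w F) 
    by move=> t x _; have [dtw dxw cw _] := h 0%N; split=> //; exact: cw.
  elim/last_ind: w k F hF => [//|w b IH] k F hF.
  rewrite /partial foldr_rcons; apply: IH => l.
  by have [_ _ _ []] := hF l.+1; case: b.
have base G : smooth_on [set: R] G -> [/\ forall t x, derivable (G^~ x) t 1,
    forall t x, derivable (G t) x 1 & continuous (joint G)].
  move=> sG; split=> [t x|t x|[t x]]; have [dtG dxG cG] := sG [::] t x I.
  - exact: dtG.
  - exact: dxG.
  - exact: cG.
elim: k F sF => [|k IH] F sF; have [dtF dxF cF] := base F sF.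
  exact: And4 dtF dxF cF I.
suff h : joint_derivs k (dt F) /\ joint_derivs k (dx F) by exact: And4 dtF dxF cF h.
split; apply: IH => w t x _.
  by have := sF (rcons w true) t x I; rewrite /partial foldr_rcons.
by have := sF (rcons w false) t x I; rewrite /partial foldr_rcons.
Qed.

Lemma joint_derivsW k F : joint_derivs k.+1 F -> joint_derivs k F.
Proof.
elim: k F => [|k IH] F [dtF dxF cF]; first by move=> _; split.
by move=> [/IH ? /IH ?]; split.
Qed.

Lemma dt_is_derive F G : (forall t x, is_derive t 1 (F^~ x) (G t x)) ->
  (forall t x, derivable (F^~ x) t 1) /\ dt F = G.
Proof.
move=> h; split=> [t x|]; first by have [] := h t x.
by apply/funext => t; apply/funext => x; apply: derive1_is_derive.
Qed.

Lemma dx_is_derive F G : (forall t x, is_derive x 1 (F t) (G t x)) ->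
  (forall t x, derivable (F t) x 1) /\ dx F = G.
Proof.
move=> h; split=> [t x|]; first by have [] := h t x.
by apply/funext => t; apply/funext => x; apply: derive1_is_derive.
Qed.

Lemma joint_derivsS k F G H :
  (forall t x, is_derive t 1 (F^~ x) (G t x)) ->
  (forall t x, is_derive x 1 (F t) (H t x)) ->
  continuous (joint F) ->
  joint_derivs k G -> joint_derivs k H -> joint_derivs k.+1 F.
Proof.
move=> /dt_is_derive[dtF <-] /dx_is_derive[dxF <-] cF hG hH.
exact: And4 dtF dxF cF (conj hG hH).
Qed.

Lemma joint_derivs0 F G H :
  (forall t x, is_derive t 1 (F^~ x) (G t x)) ->
  (forall t x, is_derive x 1 (F t) (H t x)) ->
  continuous (joint F) -> joint_derivs 0 F.
Proof.
move=> /dt_is_derive[dtF _] /dx_is_derive[dxF _] cF.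
exact: And4 dtF dxF cF I.
Qed.

Lemma joint_derivs_is_derive_dt k F t x : joint_derivs k F ->
  is_derive t 1 (F^~ x) (dt F t x).
Proof. by case: k => [|k] [dtF _ _ _]; exact/is_derive_derive1. Qed.

Lemma joint_derivs_is_derive_dx k F t x : joint_derivs k F ->
  is_derive x 1 (F t) (dx F t x).
Proof. by case: k => [|k] [_ dxF _ _]; exact/is_derive_derive1. Qed.

Lemma joint_derivs_continuous k F : joint_derivs k F -> continuous (joint F).
Proof. by case: k => [|k] []. Qed.

Lemma joint_derivsD k F G : joint_derivs k F -> joint_derivs k G ->
  joint_derivs k (fun t x => F t x + G t x).
Proof.
have dtD l A B t x : joint_derivs l A -> joint_derivs l B ->
    is_derive t 1 ((fun t x => A t x + B t x) ^~ x) (dt A t x + dt B t x).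
  move=> /(joint_derivs_is_derive_dt t x) dA /(joint_derivs_is_derive_dt t x) dB.
  exact: is_deriveD.
have dxD l A B t x : joint_derivs l A -> joint_derivs l B ->
    is_derive x 1 ((fun t x => A t x + B t x) t) (dx A t x + dx B t x).
  move=> /(joint_derivs_is_derive_dx t x) dA /(joint_derivs_is_derive_dx t x) dB.
  exact: is_deriveD.
have cD l A B : joint_derivs l A -> joint_derivs l B ->
    continuous (joint (fun t x => A t x + B t x)).
  move=> hA hB p.
  apply: cvgD; first exact: (joint_derivs_continuous hA).
  exact: (joint_derivs_continuous hB).
elim: k F G => [|k IH] F G hF hG.
  by apply: joint_derivs0 => [t x|t x|];
    [exact: dtD hF hG|exact: dxD hF hG|exact: cD hF hG].
apply: joint_derivsS => [t x|t x|||];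
  [exact: dtD hF hG|exact: dxD hF hG|exact: cD hF hG| |].
- by have [_ _ _ [? _]] := hF; have [_ _ _ [? _]] := hG; exact: IH.
- by have [_ _ _ [_ ?]] := hF; have [_ _ _ [_ ?]] := hG; exact: IH.
Qed.

Lemma joint_derivsM k F G : joint_derivs k F -> joint_derivs k G ->
  joint_derivs k (fun t x => F t x * G t x).
Proof.
have dtM l A B t x : joint_derivs l A -> joint_derivs l B ->
    is_derive t 1 ((fun t x => A t x * B t x) ^~ x)
      (A t x * dt B t x + dt A t x * B t x).
  move=> /(joint_derivs_is_derive_dt t x) dA /(joint_derivs_is_derive_dt t x) dB.
  apply: (is_derive_eq (is_deriveM dA dB)).
  by rewrite /GRing.scale/= [B t x * _]mulrC.
have dxM l A B t x : joint_derivs l A -> joint_derivs l B ->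
    is_derive x 1 ((fun t x => A t x * B t x) t)
      (A t x * dx B t x + dx A t x * B t x).
  move=> /(joint_derivs_is_derive_dx t x) dA /(joint_derivs_is_derive_dx t x) dB.
  apply: (is_derive_eq (is_deriveM dA dB)).
  by rewrite /GRing.scale/= [B t x * _]mulrC.
have cM l A B : joint_derivs l A -> joint_derivs l B ->
    continuous (joint (fun t x => A t x * B t x)).
  move=> hA hB p.
  apply: cvgM; first exact: (joint_derivs_continuous hA).
  exact: (joint_derivs_continuous hB).
elim: k F G => [|k IH] F G hF hG.
  by apply: joint_derivs0 => [t x|t x|];
    [exact: dtM hF hG|exact: dxM hF hG|exact: cM hF hG].
apply: joint_derivsS => [t x|t x|||];
  [exact: dtM hF hG|exact: dxM hF hG|exact: cM hF hG| |].
- have [_ _ _ [dtF _]] := hF; have [_ _ _ [dtG _]] := hG.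
  by apply: joint_derivsD; apply: IH => //; exact: joint_derivsW.
- have [_ _ _ [_ dxF]] := hF; have [_ _ _ [_ dxG]] := hG.
  by apply: joint_derivsD; apply: IH => //; exact: joint_derivsW.
Qed.

Lemma joint_derivs_comp1 k f F : smooth f -> joint_derivs k F ->
  joint_derivs k (fun t x => f (F t x)).
Proof.
have dtc g l A t x : smooth g -> joint_derivs l A ->
    is_derive t 1 ((fun t x => g (A t x)) ^~ x) (g^`()%classic (A t x) * dt A t x).
  move=> sg /(joint_derivs_is_derive_dt t x) dA.
  have dg := is_derive_derive1 (sg 0%N (A t x)).
  exact: (@is_derive1_comp _ g (A^~ x)).
have dxc g l A t x : smooth g -> joint_derivs l A ->
    is_derive x 1 ((fun t x => g (A t x)) t) (g^`()%classic (A t x) * dx A t x).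
  move=> sg /(joint_derivs_is_derive_dx t x) dA.
  have dg := is_derive_derive1 (sg 0%N (A t x)).
  exact: (@is_derive1_comp _ g (A t)).
have cc g l A : smooth g -> joint_derivs l A ->
    continuous (joint (fun t x => g (A t x))).
  move=> sg /joint_derivs_continuous cA p.
  apply: (@continuous_comp _ _ _ (joint A) g); first exact: cA.
  exact: (smooth_continuous (n := 0) sg).
elim: k f F => [|k IH] f F sf hF.
  by apply: joint_derivs0 => [t x|t x|];
    [exact: dtc hF|exact: dxc hF|exact: cc hF].
have sf' := smooth_derive1n (n := 1) sf; have [_ _ _ [dtF dxF]] := hF.
apply: joint_derivsS => [t x|t x|||];
  [exact: dtc hF|exact: dxc hF|exact: cc hF| |];
  by apply: joint_derivsM => //; apply: IH => //; exact: joint_derivsW.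
Qed.

Lemma joint_derivs_cst k (a : R) : joint_derivs k (fun _ _ => a).
Proof.
have ds (b x : R) : is_derive x 1 (fun=> b) 0 by exact: is_derive_cst.
have cc (b : R) : continuous (joint (fun _ _ => b)) by move=> p; exact: cvg_cst.
elim: k a => [|k IH] a.
  exact: (@joint_derivs0 _ (fun _ _ => 0) (fun _ _ => 0) (fun t x => ds a t)
    (fun t x => ds a x) (cc a)).
exact: (@joint_derivsS _ _ (fun _ _ => 0) (fun _ _ => 0) (fun t x => ds a t)
  (fun t x => ds a x) (cc a)).
Qed.

Lemma joint_derivs_fst k : joint_derivs k (fun t _ => t).
Proof.
have cf : continuous (joint (fun t _ : R => t)) by move=> p; exact: cvg_fst.
have ds (b x : R) : is_derive x 1 (fun=> b) 0 by exact: is_derive_cst.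
have di (x : R) : is_derive x 1 id 1 by exact: is_derive_id.
case: k => [|k].
  exact: (@joint_derivs0 _ (fun _ _ => 1) (fun _ _ => 0) (fun t x => di t)
    (fun t x => ds t x) cf).
exact: (@joint_derivsS _ _ (fun _ _ => 1) (fun _ _ => 0) (fun t x => di t)
    (fun t x => ds t x) cf (joint_derivs_cst _ _) (joint_derivs_cst _ _)).
Qed.

Lemma joint_derivs_snd k : joint_derivs k (fun _ x => x).
Proof.
have cf : continuous (joint (fun _ x : R => x)) by move=> p; exact: cvg_snd.
have ds (b x : R) : is_derive x 1 (fun=> b) 0 by exact: is_derive_cst.
have di (x : R) : is_derive x 1 id 1 by exact: is_derive_id.
case: k => [|k].
  exact: (@joint_derivs0 _ (fun _ _ => 0) (fun _ _ => 1) (fun t x => ds x t)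
    (fun t x => di x) cf).
exact: (@joint_derivsS _ _ (fun _ _ => 0) (fun _ _ => 1) (fun t x => ds x t)
    (fun t x => di x) cf (joint_derivs_cst _ _) (joint_derivs_cst _ _)).
Qed.

Lemma joint_continuous_comp2 F G : continuous (joint F) ->
  continuous (joint G) -> continuous (joint (fun t x => F t (G t x))).
Proof.
move=> cF cG [t x]; apply/joint_continuousP => e e0.
have /joint_continuousP/(_ e e0)[d d0 dP] := cF (t, G t x).
have /joint_continuousP/(_ d d0)[d1 d10 d1P] := cG (t, x).
exists (Num.min d d1); first by rewrite lt_min d0.
move=> s y; rewrite !lt_min => /andP[sd sd1] /andP[_ yd1].
by apply: dP => //; exact: d1P.
Qed.

(** One more order is asked of [F] because the chain rule in [t] uses joint continuity of [dx F],
    which [joint_derivs 0] does not contain. *)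
Lemma joint_derivs_comp2 k F G : joint_derivs k.+1 F -> joint_derivs k G ->
  joint_derivs k (fun t x => F t (G t x)).
Proof.
have dtc l A B t x : joint_derivs l.+1 A -> joint_derivs l B ->
    is_derive t 1 ((fun t x => A t (B t x)) ^~ x)
      (dt A t (B t x) + dx A t (B t x) * dt B t x).
  move=> hA /(joint_derivs_is_derive_dt t x) dB.
  have [_ dxA _ [_ /joint_derivs_continuous cdxA]] := hA.
  apply: (@chain_rule _ setT A (B^~ x) t) => //.
  - exact: openT.
  - exact: cdxA.
  - exact: joint_derivs_is_derive_dt hA.
have dxc l A B t x : joint_derivs l.+1 A -> joint_derivs l B ->
    is_derive x 1 ((fun t x => A t (B t x)) t) (dx A t (B t x) * dx B t x).
  move=> /(joint_derivs_is_derive_dx t (B t x)) dA.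
  move=> /(joint_derivs_is_derive_dx t x) dB.
  exact: (@is_derive1_comp _ (A t) (B t)).
have cc l A B : joint_derivs l.+1 A -> joint_derivs l B ->
    continuous (joint (fun t x => A t (B t x))).
  move=> /joint_derivs_continuous cA /joint_derivs_continuous cB.
  exact: joint_continuous_comp2.
elim: k F G => [|k IH] F G hF hG.
  by apply: joint_derivs0 => [t x|t x|];
    [exact: dtc hF hG|exact: dxc hF hG|exact: cc hF hG].
have [_ _ _ [dtF dxF]] := hF; have [_ _ _ [dtG dxG]] := hG.
have hGk := joint_derivsW hG.
apply: joint_derivsS => [t x|t x|||];
  [exact: dtc hF hG|exact: dxc hF hG|exact: cc hF hG| |].
- exact: (joint_derivsD (IH _ _ dtF hGk) (joint_derivsM (IH _ _ dxF hGk) dtG)).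
- exact: (joint_derivsM (IH _ _ dxF hGk) dxG).
Qed.

End joint_derivs.

(** * Flows and their velocity fields *)

Lemma is_derive_div (R : realType) (f g : R -> R) (x a b : R) : g x != 0 ->
  is_derive x 1 f a -> is_derive x 1 g b ->
  is_derive x 1 (fun y => f y / g y) ((a * g x - f x * b) / g x ^+ 2).
Proof.
move=> g0 df dg; apply: (is_derive_eq (is_deriveM df (is_deriveV g0 dg))).
by rewrite /GRing.scale/=; field.
Qed.

Section smooth_on_theory.
Context {R : realType}.
Implicit Types (J : set R) (F : R -> R -> R) (t x : R).

Lemma smooth_on_partial J F w : smooth_on J F -> smooth_on J (partial w F).
Proof.
by move=> sF w' t x Jt; have := sF (w' ++ w) t x Jt; rewrite /partial foldr_cat.
Qed.

Lemma smooth_on_dt J F : smooth_on J F -> smooth_on J (dt F).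
Proof. exact: (@smooth_on_partial J F [:: true]). Qed.

Lemma smooth_on_dx J F : smooth_on J F -> smooth_on J (dx F).
Proof. exact: (@smooth_on_partial J F [:: false]). Qed.

Lemma smooth_on_is_derive_dt J F t x : smooth_on J F -> J t ->
  is_derive t 1 (F^~ x) (dt F t x).
Proof.
move=> sF Jt; have [dF _ _] := sF [::] t x Jt.
exact: (is_derive_derive1 dF).
Qed.

Lemma smooth_on_is_derive_dx J F t x : smooth_on J F -> J t ->
  is_derive x 1 (F t) (dx F t x).
Proof.
move=> sF Jt; have [_ dF _] := sF [::] t x Jt.
exact: (is_derive_derive1 dF).
Qed.

Lemma smooth_on_continuous J F t x : smooth_on J F -> J t ->
  {for (t, x), continuous (joint F)}.
Proof. by move=> sF Jt; have [_ _ cF] := sF [::] t x Jt; exact: cF. Qed.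

Lemma smooth_on_smooth J F t : smooth_on J F -> J t -> smooth (F t).
Proof.
move=> sF Jt n x; have -> : (F t)^`(n) = partial (nseq n false) F t.
  by elim: n => [//|n IH]; rewrite derive1nS IH.
by have [_ + _] := sF (nseq n false) t x Jt.
Qed.

Lemma smooth_on_chain J F psi t b : open J -> J t -> smooth_on J F ->
  is_derive t 1 psi b ->
  is_derive t 1 (fun s => F s (psi s)) (dt F t (psi t) + dx F t (psi t) * b).
Proof.
move=> oJ Jt sF dpsi.
have dF s y : J s -> derivable (F s) y 1.
  by move=> Js; have [] := smooth_on_is_derive_dx y sF Js.
have cF : {for (t, psi t), continuous (joint (dx F))}.
  exact: (smooth_on_continuous (smooth_on_dx sF) Jt).
exact: (chain_rule oJ Jt dF cF (smooth_on_is_derive_dt (psi t) sF Jt) dpsi).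
Qed.

End smooth_on_theory.

Section flow.
Context {R : realType}.
Variables (J : set R) (phi : R -> R -> R).
Hypotheses (oJ : open J) (sphi : smooth_flow J phi).
Notation psi := (flow_inverse phi).
Implicit Types (t x y : R).

Lemma flowK t : J t -> cancel (phi t) (psi t) /\ cancel (psi t) (phi t).
Proof. by move=> Jt; have [bphi _ _] := sphi.2 t Jt; exact: inverseK. Qed.

(** The inverse is differentiable by the definition of a diffeomorphism, so differentiating phi o
    psi = id forces the Jacobian to be nonzero. *)
Lemma flow_dx_inverse t x : J t -> dx phi t (psi t x) != 0 /\
  is_derive x 1 (psi t) (dx phi t (psi t x))^-1.
Proof.
move=> Jt; have [_ _ /(_ 0%N x) /is_derive_derive1 dpsi] := sphi.2 t Jt.
have dphi := smooth_on_is_derive_dx (psi t x) sphi.1 Jt.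
have E : dx phi t (psi t x) * (psi t)^`()%classic x = 1.
  rewrite -(derive1_is_derive (is_derive1_comp dphi dpsi)).
  have -> : phi t \o psi t = id by apply/funext => y; have [_] := flowK Jt; exact.
  exact: derive1_id.
have n0 : dx phi t (psi t x) != 0.
  by apply/eqP => E0; move/eqP: E; rewrite E0 mul0r eq_sym oner_eq0.
split=> //; suff <- : (psi t)^`()%classic x = (dx phi t (psi t x))^-1 by [].
by apply: (mulfI n0); rewrite E divff.
Qed.

(** [smooth_flow] says nothing about the inverse as a function of [t]; its continuity is obtained
    first, by [inverse_continuous], then its derivative, by [implicit_derive]. *)
Lemma flow_dt_inverse t x : J t ->
  is_derive t 1 (psi^~ x) (- dt phi t (psi t x) / dx phi t (psi t x)).
Proof.
move=> Jt; have cphi s y : J s -> {for (s, y), continuous (joint phi)}.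
  by move=> Js; exact: smooth_on_continuous sphi.1 Js.
have dphi s y : J s -> derivable (phi s) y 1.
  by move=> Js; have [] := smooth_on_is_derive_dx y sphi.1 Js.
have cpsi : {for (t, x), continuous (joint psi)}.
  apply: (inverse_continuous oJ Jt cphi) => s Js; last exact: flowK.
  by move=> y; exact/derivable_continuous/dphi.
have ct : {for t, continuous (psi^~ x)}.
  apply: eps_continuous => e e0.
  have /joint_continuousP/(_ e e0)[d d0 dP] := cpsi.
  by exists d => // s st; apply: dP; rewrite ?subrr ?normr0.
have cdphi : {for (t, psi t x), continuous (joint (dx phi))}.
  exact: (smooth_on_continuous (smooth_on_dx sphi.1) Jt).
have phipsi s : J s -> phi s (psi s x) = x by move=> Js; have [_] := flowK Js; exact.
have [n0 _] := flow_dx_inverse x Jt.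
have dtphi := smooth_on_is_derive_dt (psi t x) sphi.1 Jt.
exact: (implicit_derive (psi := psi^~ x) oJ Jt dphi cdphi ct phipsi dtphi n0).
Qed.

Lemma dx_velocity t x : J t ->
  dx (velocity phi) t x = dx (dt phi) t (psi t x) / dx phi t (psi t x).
Proof.
move=> Jt; have [n0 dpsi] := flow_dx_inverse x Jt.
have dA := smooth_on_is_derive_dx (psi t x) (smooth_on_dt sphi.1) Jt.
exact: (derive1_is_derive (is_derive1_comp dA dpsi)).
Qed.

(** Put h = phi_tx / phi_x. Then u_x = h o psi, and since psi_t = - phi_t / phi_x and psi_x = 1 /
    phi_x along psi, the terms - h_x phi_t / phi_x of u_xt and + h_x phi_t / phi_x of u_xx u cancel,
    leaving h_t. *)
Lemma eulerian_velocity t x : J t ->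
  dt (dx (velocity phi)) t x + dx (dx (velocity phi)) t x * velocity phi t x =
  dt (fun s y => dx (dt phi) s y / dx phi s y) t (psi t x).
Proof.
move=> Jt; have [n0 dpsi] := flow_dx_inverse x Jt.
have sA := smooth_on_dx (smooth_on_dt sphi.1).
have sB := smooth_on_dx sphi.1.
have dtpsi := flow_dt_inverse x Jt.
have At := smooth_on_chain oJ Jt sA dtpsi.
have Bt := smooth_on_chain oJ Jt sB dtpsi.
have Ax := is_derive1_comp (smooth_on_is_derive_dx (psi t x) sA Jt) dpsi.
have Bx := is_derive1_comp (smooth_on_is_derive_dx (psi t x) sB Jt) dpsi.
pose A := dx (dt phi); pose B := dx phi; pose y := psi t x.
pose y' := - dt phi t y / B t y.
have Exx : dx (dx (velocity phi)) t x =
    (dx A t y * (B t y)^-1 * B t y - A t y * (dx B t y * (B t y)^-1)) / B t y ^+ 2.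
  have E : dx (velocity phi) t = (fun z => A t (psi t z) / B t (psi t z)).
    by apply/funext => z; exact: dx_velocity.
  have D : is_derive x 1 (fun z => A t (psi t z) / B t (psi t z)) _ :=
    is_derive_div (g := fun z => B t (psi t z)) n0 Ax Bx.
  exact: etrans (congr1 (fun f : R -> R => f^`()%classic x) E) (derive1_is_derive D).
have Etx : dt (dx (velocity phi)) t x =
    ((dt A t y + dx A t y * y') * B t y - A t y * (dt B t y + dx B t y * y')) / B t y ^+ 2.
  have D : is_derive t 1 (fun s => A s (psi s x) / B s (psi s x)) _ :=
    is_derive_div (g := fun s => B s (psi s x)) n0 At Bt.
  have nE : \forall s \near t,
      A s (psi s x) / B s (psi s x) = dx (velocity phi) s x.
    have [d d0 dP] := open_eps oJ Jt.
    apply: filterS (nbhsx_ballx t d d0) => s; rewrite /ball/= distrC => /dP Js.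
    by rewrite dx_velocity.
  exact: (derive1_is_derive (@near_eq_is_derive _ R R _ _ _ _ _ nE D)).
have dtA := smooth_on_is_derive_dt y sA Jt.
have dtB := smooth_on_is_derive_dt y sB Jt.
have Eh : dt (fun s y => A s y / B s y) t y =
    (dt A t y * B t y - A t y * dt B t y) / B t y ^+ 2.
  have D : is_derive t 1 (fun s => A s y / B s y) _ :=
    is_derive_div (g := B^~ y) n0 dtA dtB.
  exact: derive1_is_derive D.
rewrite Exx Etx Eh {Exx Etx Eh} /velocity -/y /y'.
rewrite -/B -/y in n0; move: n0.
generalize (dt A t y) (dx A t y) (dt B t y) (dx B t y) (A t y) (B t y) (dt phi t y).
by move=> At' Ax' Bt' Bx' a b p n0; clear -n0; field.
Qed.

Lemma eulerian_lagrangian :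
  eulerian_equation J (velocity phi) <-> lagrangian_equation J phi.
Proof.
split=> h t x Jt; last exact: etrans (eulerian_velocity x Jt) (h _ _ Jt).
have := etrans (esym (eulerian_velocity (phi t x) Jt)) (h _ _ Jt).
by have [-> _] := flowK Jt.
Qed.

End flow.

(** * Derivatives of a sequence tending pointwise to zero *)

Section pointwise_limits.
Context {R : realType}.
Implicit Types (J : set R) (f g : nat -> R -> R) (c : R -> R) (t : R).

(* By Baire's theorem, some set of points where all late derivatives are at
   least e contains an interval; this contradicts the mean value theorem. *)
Let limit_derive_le0 J f c : open J ->
  (forall n t, J t -> derivable (f n) t 1) ->
  (forall n t, J t -> {for t, continuous (f n)^`()}) ->
  (forall t, J t -> {for t, continuous c}) ->
  (forall t, J t -> f n t @[n --> \oo] --> (0 : R)) ->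
  (forall t, J t -> (f n)^`()%classic t @[n --> \oo] --> c t) ->
  forall t, J t -> c t <= 0.
Proof.
move=> oJ df cf' cc f0 f'c t Jt; rewrite leNgt; apply/negP => ct0.
pose e := c t / 2; have e0 : 0 < e by rewrite divr_gt0.
have [d1 d10 d1P] := open_eps oJ Jt.
have [d2 d20 d2P] := continuous_eps (cc t Jt) e0.
pose d := Num.min d1 d2 / 2.
have m0 : 0 < Num.min d1 d2 by rewrite lt_min d10.
have d0 : 0 < d by rewrite divr_gt0.
have dm : d < Num.min d1 d2 by rewrite /d; lra.
have KJ s : `|s - t| <= d -> J s.
  by move=> /le_lt_trans/(_ dm); rewrite lt_min => /andP[/d1P].
have Kc s : `|s - t| <= d -> e < c s.
  move=> /le_lt_trans/(_ dm); rewrite lt_min => /andP[_ /d2P].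
  by rewrite ltr_norml /e => /andP[+ _]; lra.
pose F N := [set s | `|s - t| <= d /\ forall n, (N <= n)%N -> e <= (f n)^`()%classic s].
(* The complements of the [F N] are open. Were they all dense, Baire's theorem would give a point
   near [t] outside every [F N], although the derivatives there tend to a value of [c] larger than
   [e]. *)
have [N nN] : exists N, ~ dense (~` F N).
  apply: contrapT => /forallNP dF.
  have oF N : open (~` F N).
    rewrite openE => s /= nFs; have [sd|sd] := leP `|s - t| d; last first.
      have := nbhsx_ballx s (`|s - t| - d); rewrite subr_gt0 => /(_ sd).
      apply: filterS => u; rewrite /ball/= => su [ud _].
      have := ler_distD u s t; lra.
    have [n [Nn ns]] : exists n, (N <= n)%N /\ (f n)^`()%classic s < e.
      apply: contrapT => h; apply: nFs; split=> // n Nn; rewrite leNgt.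
      by apply/negP => ns; apply: h; exists n.
    have e'0 : 0 < e - (f n)^`()%classic s by rewrite subr_gt0.
    have [d' d'0 d'P] := continuous_eps (cf' n s (KJ s sd)) e'0.
    apply: filterS (nbhsx_ballx s d' d'0) => u; rewrite /ball/= distrC => /d'P.
    by move=> + [_ /(_ n Nn)]; rewrite ltr_norml => /andP[]; lra.
  have /(_ (ball t d)) : dense (\bigcap_N (~` F N)).
    by apply: Baire => N; split; [exact: oF|exact: contrapT (dF N)].
  case.
  - by exists t; exact: ballxx.
  - exact: ball_open.
  move=> s [/= sd sF]; have {}sd : `|s - t| <= d by rewrite distrC ltW.
  have e'0 : 0 < c s - e by rewrite subr_gt0 Kc.
  have /cvgrPdist_lt/(_ _ e'0)[N _ NP] := f'c s (KJ s sd).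
  apply: (sF N I); split=> // n Nn; have := NP n Nn.
  by rewrite /= ltr_norml => /andP[_]; lra.
have [A [[s As] [oA AF]]] : exists A : set R, A !=set0 /\ open A /\ A `<=` F N.
  apply: contrapT => /forallNP h; apply: nN => A A0 oA; apply: contrapT => n0.
  apply: (h A); split=> //; split=> // s As; apply: contrapT => nF.
  by apply: n0; exists s.
have [r r0 rA] := open_eps oA As.
pose u := s + r / 2.
have us : `|u - s| = r / 2 by rewrite /u addrC addKr gtr0_norm ?divr_gt0.
have seg z : `|z - s| <= `|u - s| -> F N z.
  by rewrite us => zs; apply/AF/rA; lra.
(* This lower bound is uniform in [n], while [f n u] and [f n s] both tend to 0. *)
have diff n : (N <= n)%N -> e * (r / 2) <= f n u - f n s.
  move=> Nn; have [|z zs ->] := @MVT_between _ (f n) s u.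
    by move=> z /seg[/KJ Jz _]; exact: df.
  have [_ /(_ n Nn) ez] := seg z zs.
  have -> : u - s = r / 2 by rewrite /u addrC addKr.
  by rewrite ler_wpM2r// ltW// divr_gt0.
have Fs : F N s by apply: seg; rewrite subrr normr0.
have Fu : F N u by exact: seg.
have er : 0 < e * (r / 2) by rewrite mulr_gt0// divr_gt0.
have : f n u - f n s @[n --> \oo] --> (0 - 0 : R).
  by apply: cvgB; apply: f0; apply: KJ; [have [] := Fu|have [] := Fs].
rewrite subr0 => /cvgrPdist_lt/(_ _ er)[M _ MP].
have := MP (maxn N M) (leq_maxr _ _); have := diff (maxn N M) (leq_maxl _ _).
by rewrite /= sub0r normrN ltr_norml => h /andP[_]; lra.
Qed.

Lemma limit_derive_eq0 J f c : open J ->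
  (forall n t, J t -> derivable (f n) t 1) ->
  (forall n t, J t -> {for t, continuous (f n)^`()}) ->
  (forall t, J t -> {for t, continuous c}) ->
  (forall t, J t -> f n t @[n --> \oo] --> (0 : R)) ->
  (forall t, J t -> (f n)^`()%classic t @[n --> \oo] --> c t) ->
  forall t, J t -> c t = 0.
Proof.
move=> oJ df cf' cc f0 f'c t Jt; apply/eqP; rewrite eq_le.
rewrite (limit_derive_le0 oJ df cf' cc f0 f'c Jt)/= -oppr_le0.
have f'N n s : J s -> (\- f n)^`()%classic s = - (f n)^`()%classic s.
  by move=> Js; rewrite derive1N//; exact: df.
apply: (limit_derive_le0 (f := fun n => \- f n) (c := \- c) oJ).
- by move=> n s Js; apply: derivableN; exact: df.
- move=> n s Js; have cN : {for s, continuous (\- (f n)^`()%classic)}.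
    by apply: continuousN; exact: cf'.
  apply: eps_continuous => e e0; have [d d0 dP] := continuous_eps cN e0.
  have [d1 d10 d1P] := open_eps oJ Js.
  exists (Num.min d d1); first by rewrite lt_min d0.
  move=> y; rewrite lt_min => /andP[yd yd1].
  by rewrite !f'N//; [exact: dP|exact: d1P].
- by move=> s Js; apply: continuousN; exact: cc.
- by move=> s Js; rewrite -oppr0; apply: cvgN; exact: f0.
- move=> s Js; have -> : (fun n => (\- f n)^`()%classic s) =
      (fun n => - (f n)^`()%classic s) by apply/funext => n; rewrite f'N.
  by apply: cvgN; exact: f'c.
- exact: Jt.
Qed.

End pointwise_limits.

(** * Eulerian and Proudman-Johnson equations *)

Section proudman_johnson.
Context {R : realType}.
Variables (J : set R) (u : R -> R -> R).
Hypotheses (oJ : open J) (au : admissible_field J u).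
Implicit Types (t x : R).

Let su : smooth_on J u := au.1.

(** The product rule produces u_xtx where the Proudman-Johnson equation has u_txx; [schwarz] bridges
    the two. *)
Let eulerian_dx t x : J t ->
  is_derive x 1 (fun y => dt (dx u) t y + dx (dx u) t y * u t y)
    (dx (dx (dt u)) t x + (1 + 2 * 0) * dx u t x * dx (dx u) t x
    + u t x * dx (dx (dx u)) t x).
Proof.
move=> Jt; have d1 := smooth_on_is_derive_dx x (smooth_on_dt (smooth_on_dx su)) Jt.
have d2 := smooth_on_is_derive_dx x (smooth_on_dx (smooth_on_dx su)) Jt.
have d3 := smooth_on_is_derive_dx x su Jt.
apply: (is_derive_eq (is_deriveD d1 (is_deriveM d2 d3))).
have E : dt (dx u) t = dx (dt u) t by apply/funext => y; exact: schwarz oJ Jt su.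
have : dx (dt (dx u)) t x = dx (dx (dt u)) t x :=
  congr1 (fun f : R -> R => f^`()%classic x) E.
generalize (dx (dt (dx u)) t x) (dx (dx (dt u)) t x) (dx (dx (dx u)) t x).
generalize (dx (dx u) t x) (dx u t x) (u t x) => a b c d e f -> {d}.
by rewrite /GRing.scale/=; ring.
Qed.

Lemma cvg_dx_Ny t : J t ->
  [/\ u t x @[x --> -oo] --> (0 : R), dx u t x @[x --> -oo] --> (0 : R)
    & dx (dx u) t x @[x --> -oo] --> (0 : R)].
Proof.
move=> Jt; have [s wu u0] := au.2 t Jt.
have s1 := smooth_derive1n (n := 1) s; have s2 := smooth_derive1n (n := 1) s1.
have L n : L1 (u t)^`()^`(n) := sobolev1_infty_L1 n s1 wu.
split=> //; apply: L1_derive1_cvgNy.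
- exact: (s1 0%N).
- exact: (smooth_continuous (n := 1) s1).
- exact: (L 0%N).
- exact: (L 1%N).
- exact: (s2 0%N).
- exact: (smooth_continuous (n := 1) s2).
- exact: (L 1%N).
- exact: (L 2%N).
Qed.

Lemma eulerian_proudman_johnson :
  eulerian_equation J u <-> generalized_proudman_johnson 0 J u.
Proof.
split=> [h t x Jt|h].
  rewrite -(derive1_is_derive (eulerian_dx x Jt)).
  by rewrite (_ : (fun _ => _) = cst 0) ?derive1_cst//; apply/funext => y; exact: h.
pose c t := dt (dx u) t 0 + dx (dx u) t 0 * u t 0.
have cE t x : J t -> dt (dx u) t x + dx (dx u) t x * u t x = c t.
  move=> Jt; apply: (is_derive_0_is_cst
    (f := fun y => dt (dx u) t y + dx (dx u) t y * u t y)) => y.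
  by rewrite -(h t y Jt); exact: eulerian_dx.
have cvgn (f : R -> R) (l : R) : f x @[x --> -oo] --> l -> f (- n%:R) @[n --> \oo] --> l.
  move=> /cvg_ninftyP; apply.
  apply/cvgrNyPle => A; have := nbhs_infty_ger (- A).
  by apply: filterS => n; rewrite lerNl.
have slice F : smooth_on J F -> forall x s, J s -> {for s, continuous (F^~ x)}.
  move=> sF x s Js; apply: derivable_continuous.
  by have [] := smooth_on_is_derive_dt x sF Js.
suff c0 t : J t -> c t = 0 by move=> t x Jt; rewrite cE// c0.
(* Sampling at -n provides the sequence that the Baire argument requires. *)
apply: (limit_derive_eq0 (f := fun n s => dx u s (- n%:R)) oJ).
- by move=> n s Js; have [] := smooth_on_is_derive_dt (- n%:R) (smooth_on_dx su) Js.
- by move=> n s Js; exact: slice (smooth_on_dt (smooth_on_dx su)) (- n%:R) s Js.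
- move=> s Js; apply: cvgD; first exact: slice (smooth_on_dt (smooth_on_dx su)) _ _ Js.
  apply: cvgM; first exact: slice (smooth_on_dx (smooth_on_dx su)) _ _ Js.
  exact: slice su _ _ Js.
- by move=> s Js; have [_ + _] := cvg_dx_Ny Js; exact: cvgn.
- move=> s Js; have [u0 _ uxx0] := cvg_dx_Ny Js.
  have -> : (fun n : nat => (fun r => dx u r (- n%:R))^`()%classic s) =
      (fun n : nat => c s - dx (dx u) s (- n%:R) * u s (- n%:R)).
    by apply/funext => n; rewrite -(cE s (- n%:R) Js) addrK.
  rewrite -[X in _ --> X]subr0 -(mulr0 (0 : R)).
  by apply: cvgB; [exact: cvg_cst|apply: cvgM; exact: cvgn].
Qed.

End proudman_johnson.

(** * The flow phi_infty *)

Section exponential_bounds.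
Context {R : realType}.
Implicit Types (a b T M x : R).

Lemma smooth_expR : smooth (@expR R).
Proof.
move=> n x; suff -> : expR^`(n) = expR :> (R -> R) by exact: derivable_expR.
elim: n => [//|n IH]; rewrite derive1nS IH.
by apply/funext => y; apply: derive1_is_derive; exact: is_derive_expR.
Qed.

Lemma expR_sub1_le a : `|expR a - 1| <= `|a| * expR `|a|.
Proof.
have [a0|a0] := leP 0 a.
  rewrite !ger0_norm ?subr_ge0 ?expR_ge1//; last first.
    by rewrite -(expR0 R) ler_expR.
  have -> : expR a - 1 = expR a * (1 - expR (- a)).
    by rewrite mulrBr mulr1 -expRD subrr expR0.
  rewrite mulrC ler_wpM2r ?expR_ge0//.
  by have := expR_ge1Dx (- a); lra.
rewrite distrC ger0_norm; last by rewrite subr_ge0 -[leRHS](expR0 R) ler_expR ltW.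
have := expR_ge1Dx a; rewrite ltr0_norm//.
have : 1 <= expR (- a) by rewrite -[leLHS](expR0 R) ler_expR oppr_ge0 ltW.
move=> h1 h2; apply: (@le_trans _ _ (- a)); first lra.
by rewrite ler_peMr// oppr_ge0 ltW.
Qed.

End exponential_bounds.

Section phi_infty_theory.
Context {R : realType}.
Notation mu := (@lebesgue_measure R).
Variable u0 : R -> R.
Hypothesis hu0 : g_minus_infty u0.
Implicit Types (a : R -> R) (t x y : R) (n k : nat).

Local Notation v := (u0^`()%classic).

(* For n = 0 the integrand of phi_infty, and its n-th derivative in t. *)
Definition exp_integrand n t y : R := v y ^+ n * expR (t * v y) - (n == 0%N)%:R.

(** With the index [n] the family is closed under d/dt; the flow is [x + exp_primitive 0] and its
    time derivative [exp_primitive 1]. *)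
Definition exp_primitive n t x : R := \int[mu]_(y in `]-oo, x]) exp_integrand n t y.

Definition inverse_jacobian t y : R := expR (- (t * v y)).

Local Notation g := exp_integrand.
Local Notation I := exp_primitive.
Local Notation E := inverse_jacobian.

Lemma smooth_derive1_u0 : smooth v.
Proof. by have [s _ _] := hu0; exact: (smooth_derive1n (n := 1) s). Qed.

Lemma L1_derive1_u0 n : L1 v^`(n).
Proof. by have [_ w _] := hu0; exact: (sobolev1_infty_L1 n smooth_derive1_u0 w). Qed.

Lemma derivs_derive1_u0 n : derivs bounded_L1 n v.
Proof. exact: (derivs_bounded_L1 smooth_derive1_u0 L1_derive1_u0). Qed.

Lemma derive1_u0_bound : exists2 M, 0 <= M & forall y, `|v y| <= M.
Proof.
have [[[_ [M vM]] _] _ _] := derivs_derive1_u0 0%N.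
by exists M => //; exact: le_trans (vM 0).
Qed.

(** One integrable majorant [C * |u0'|] for all |t| <= T: this is the domination for differentiating
    under the integral, and the source of Lipschitz bounds uniform in time. *)
Lemma exp_integrand_bound n T : exists2 C, 0 <= C &
  forall t y, `|t| <= T -> `|g n t y| <= C * `|v y|.
Proof.
have [M M0 vM] := derive1_u0_bound.
have tv t y : `|t| <= T -> `|t * v y| <= T * M.
  by move=> tT; rewrite normrM ler_pM.
case: n => [|n].
  exists (`|T| * expR (T * M)); first by rewrite mulr_ge0 ?expR_ge0.
  move=> t y tT; rewrite /exp_integrand expr0 mul1r eqxx.
  apply: le_trans (expR_sub1_le _) _; rewrite [leRHS]mulrAC.
  rewrite ler_pM ?expR_ge0 ?ler_expR ?tv// normrM ler_wpM2r//.
  exact: le_trans tT (ler_norm _).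
exists (M ^+ n * expR (T * M)); first by rewrite mulr_ge0 ?expR_ge0 ?exprn_ge0.
move=> t y tT; rewrite /exp_integrand subr0 normrM exprS normrM [leRHS]mulrC -mulrA.
rewrite ler_wpM2l// ler_pM// ?normrX ?lerXn2r ?nnegrE//.
by rewrite ger0_norm ?expR_ge0// ler_expR (le_trans (ler_norm _))// tv.
Qed.

Lemma joint_derivs_exp_integrand n k : joint_derivs k (g n).
Proof.
have jv := joint_derivs_comp1 smooth_derive1_u0 (joint_derivs_snd k).
have jvn : joint_derivs k (fun _ y => v y ^+ n).
  elim: n => [|n IH].
    rewrite (_ : (fun _ _ => _) = fun _ _ => 1); first exact: joint_derivs_cst.
    by apply/funext => t; apply/funext => y; rewrite expr0.
  rewrite (_ : (fun _ _ => _) = fun _ y => v y * v y ^+ n); first exact: joint_derivsM.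
  by apply/funext => t; apply/funext => y; rewrite exprS.
have jt := joint_derivsM (joint_derivs_fst k) jv.
have je := joint_derivs_comp1 smooth_expR jt.
exact: (joint_derivsD (joint_derivsM jvn je) (joint_derivs_cst k _)).
Qed.

Lemma continuous_exp_integrand n t : continuous (g n t).
Proof.
move=> y; have d := joint_derivs_is_derive_dx t y (joint_derivs_exp_integrand n 0).
by apply: derivable_continuous; case: d.
Qed.

Lemma L1_exp_integrand n t : L1 (g n t).
Proof.
have [C C0 gC] := exp_integrand_bound n `|t|.
have LCv : L1 (fun y => C * v y).
  exact: (integrableZl measurableT C (L1_derive1_u0 0%N)).
apply: (le_integrable _ _ _ LCv) => //.
  apply/measurable_EFinP; apply: continuous_measurable_fun.
  exact: continuous_exp_integrand.
by move=> y _; rewrite /= lee_fin [leRHS]normrM ger0_norm// gC.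
Qed.

Lemma exp_integrand_dt n t y : is_derive t 1 (g n ^~ y) (g n.+1 t y).
Proof.
have iE : is_derive t 1 (fun s => expR (s * v y)) (expR (t * v y) * v y).
  apply: (@is_derive1_comp _ expR (fun s => s * v y)).
  have := is_deriveM (is_derive_id t 1) (is_derive_cst (v y) t 1).
  by move=> h; apply: is_derive_eq h _; rewrite /GRing.scale/= mulr0 add0r mulr1.
have := is_deriveB (is_deriveM (is_derive_cst (v y ^+ n) t 1) iE)
  (is_derive_cst ((n == 0%N)%:R : R) t 1).
move=> h; apply: is_derive_eq h _; rewrite /exp_integrand /GRing.scale/= mulr0 addr0 !subr0.
by rewrite exprSr; ring.
Qed.

Lemma exp_primitive_dt n t x : is_derive t 1 (I n ^~ x) (I n.+1 t x).
Proof.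
have [C C0 gC] := exp_integrand_bound n.+1 (`|t| + 1).
have It : (`]t - 1, t + 1[ : set R) t by rewrite /= in_itv/= ltrBlDr ltrDl ltr01.
have mB : measurable (`]-oo, x] : set R) by exact: measurable_itv.
have LCv : mu.-integrable `]-oo, x] (EFin \o (fun y => C * `|v y|)).
  apply: (L1_itv `]-oo, x]%O).
  exact: (integrableZl measurableT C (integrable_norm (L1_derive1_u0 0%N))).
have ig s : (`]t - 1, t + 1[ : set R) s -> mu.-integrable `]-oo, x] (EFin \o g n s).
  by move=> _; exact: (L1_itv `]-oo, x]%O (L1_exp_integrand n s)).
have dg s y : (`]t - 1, t + 1[ : set R) s -> (`]-oo, x] : set R) y ->
    derivable (g n ^~ y) s 1.
  by move=> _ _; have [] := exp_integrand_dt n s y.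
have G0 y : 0 <= C * `|v y| by rewrite mulr_ge0.
have d1E s y : partial1of2 (g n) s y = g n.+1 s y.
  exact: (derive1_is_derive (exp_integrand_dt n s y)).
have ub s y : (`]t - 1, t + 1[ : set R) s -> (`]-oo, x] : set R) y ->
    `|partial1of2 (g n) s y| <= C * `|v y|.
  rewrite /= in_itv/= => /andP[s1 s2] _; rewrite d1E gC//.
  rewrite -[s](subrK t) (le_trans (ler_normD _ _))// addrC lerD2l.
  by rewrite ler_norml; apply/andP; split; lra.
have dI := derivable_under_integral (mu := mu) mB It ig dg G0 LCv ub.
have := differentiation_under_integral (mu := mu) mB It ig dg G0 LCv ub.
move=> dIE; apply: (is_derive_eq (is_derive_derive1 dI)).
by rewrite dIE; apply: eq_Rintegral => y _; exact: d1E.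
Qed.

Lemma exp_primitive_dx n t x : is_derive x 1 (I n t) (g n t x).
Proof.
exact: is_derive_RintegralNy (L1_exp_integrand n t)
  (@continuous_exp_integrand n t x).
Qed.

(** The increment is split at [(s, x)]: in [x] it is Lipschitz with constant [C * M] for all [s]
    within 1 of [t], and in [t] differentiability at the fixed [x] suffices. *)
Lemma continuous_exp_primitive n : continuous (joint (I n)).
Proof.
move=> [t x]; apply/joint_continuousP => e e0.
have tri (a b c : R) : `|a - b| < e / 2 -> `|b - c| < e / 2 -> `|a - c| < e.
  by move=> h1 h2; have := ler_distD b a c; lra.
have [C C0 gC] := exp_integrand_bound n (`|t| + 1).
have [M M0 vM] := derive1_u0_bound.
have CM0 : 0 < C * M + 1 by rewrite ltr_wpDl// mulr_ge0.
have e20 : 0 < e / 2 by rewrite divr_gt0.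
have cIt : {for t, continuous (I n ^~ x)}.
  by apply: derivable_continuous; have [] := exp_primitive_dt n t x.
have [d d0 dP] := continuous_eps cIt e20.
have e'0 : 0 < e / 2 / (C * M + 1) by rewrite divr_gt0.
exists (Num.min (Num.min d 1) (e / 2 / (C * M + 1))).
  by rewrite !lt_min d0 ltr01.
move=> s y; rewrite !lt_min => /andP[/andP[sd s1] _] /andP[_ yx].
have [|c _ cE] := @MVT_between _ (I n s) x y.
  by move=> z _; have [] := exp_primitive_dx n s z.
have {}cE : `|I n s y - I n s x| < e / 2.
  rewrite cE (derive1_is_derive (exp_primitive_dx n s c)) normrM.
  have gs : `|g n s c| <= C * M.
    apply: le_trans (gC s c _) _; last by rewrite ler_wpM2l.
    rewrite -[s](subrK t) (le_trans (ler_normD _ _))// addrC lerD2l ltW//.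
  rewrite (@le_lt_trans _ _ ((C * M + 1) * `|y - x|))//.
    by rewrite ler_wpM2r// (le_trans gs)// lerDl.
  by rewrite mulrC -ltr_pdivlMr.
exact: tri cE (dP s sd).
Qed.

Lemma joint_derivs_exp_primitive n k : joint_derivs k (I n).
Proof.
elim: k n => [|k IH] n.
  exact: (joint_derivs0 (exp_primitive_dt n) (exp_primitive_dx n)
    (@continuous_exp_primitive n)).
exact: (joint_derivsS (exp_primitive_dt n) (exp_primitive_dx n)
  (@continuous_exp_primitive n) (IH n.+1) (joint_derivs_exp_integrand n k)).
Qed.

Notation phi := (phi_infty u0).
Notation psi := (flow_inverse (phi_infty u0)).

Lemma phi_inftyE : phi = fun t x => x + I 0 t x.
Proof.
apply/funext => t; apply/funext => x; congr (_ + _); apply: eq_Rintegral => y _.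
by rewrite /exp_integrand expr0 mul1r.
Qed.

Lemma joint_derivs_phi_infty k : joint_derivs k phi.
Proof.
rewrite phi_inftyE.
exact: (joint_derivsD (joint_derivs_snd k) (joint_derivs_exp_primitive 0 k)).
Qed.

Lemma phi_infty_dx t x : is_derive x 1 (phi t) (expR (t * v x)).
Proof.
have := is_deriveD (is_derive_id x 1) (exp_primitive_dx 0 t x); rewrite phi_inftyE => h.
by apply: is_derive_eq h _; rewrite /exp_integrand expr0 mul1r addrC subrK.
Qed.

Lemma phi_infty_dt t x : is_derive t 1 (phi^~ x) (I 1 t x).
Proof.
have := is_deriveD (is_derive_cst x t 1) (exp_primitive_dt 0 t x); rewrite phi_inftyE => h.
by apply: is_derive_eq h _; rewrite add0r.
Qed.

Lemma dx_phi_infty t x : dx phi t x = expR (t * v x).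
Proof. exact: (derive1_is_derive (phi_infty_dx t x)). Qed.

Lemma dt_phi_infty : dt phi = I 1.
Proof.
apply/funext => t; apply/funext => x.
exact: (derive1_is_derive (phi_infty_dt t x)).
Qed.

(** The displacement has an integrable derivative, hence is bounded. Surjectivity of the flow and
    the limits at infinity of the flow and of its inverse all rest on this. *)
Lemma phi_infty_bound t : exists B, forall x, x - B <= phi t x <= x + B.
Proof.
have dI x : derivable (I 0 t) x 1 by have [] := exp_primitive_dx 0 t x.
have dIE : (I 0 t)^`() = g 0 t.
  by apply/funext => x; exact: (derive1_is_derive (exp_primitive_dx 0 t x)).
have [||B IB] := @L1_derive1_bounded _ (I 0 t) dI.
- by rewrite dIE; exact: continuous_exp_integrand.
- by rewrite dIE; exact: L1_exp_integrand.
by exists B => x; rewrite phi_inftyE; have := IB x; rewrite ler_norml => /andP[]; lra.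
Qed.

Lemma phi_infty_lt t : {homo phi t : x y / x < y}.
Proof.
move=> x y xy; have [|c _ cE] := @MVT_between _ (phi t) x y.
  by move=> z _; have [] := phi_infty_dx t z.
rewrite -subr_gt0 cE (derive1_is_derive (phi_infty_dx t c)).
by rewrite mulr_gt0 ?expR_gt0// subr_gt0.
Qed.

Lemma continuous_phi_infty t : continuous (phi t).
Proof. by move=> x; apply: derivable_continuous; have [] := phi_infty_dx t x. Qed.

Lemma bij_phi_infty t : bijective (phi t).
Proof.
have [B phiB] := phi_infty_bound t.
have B0 : 0 <= B by have := phiB 0; lra.
have /choice[h hK] z : exists x, phi t x = z.
  have [|||c _ <-] := @IVT R (phi t) (z - B) (z + B) z.
  - by lra.
  - exact/continuous_subspaceT/continuous_phi_infty.
  - rewrite ge_min le_max; have := phiB (z - B); have := phiB (z + B).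
    rewrite addrK subrK => /andP[-> _] /andP[_ ->].
    by rewrite orbT.
  by exists c.
exists h; last exact: hK.
move=> x; have [hx|hx|//] := ltgtP (h (phi t x)) x.
  by have := @phi_infty_lt t _ _ hx; rewrite hK ltxx.
by have := @phi_infty_lt t _ _ hx; rewrite hK ltxx.
Qed.

Lemma phi_inftyK t : cancel (phi t) (psi t) /\ cancel (psi t) (phi t).
Proof. exact/inverseK/bij_phi_infty. Qed.

Lemma inverse_phi_infty_dx t x : is_derive x 1 (psi t) (E t (psi t x)).
Proof.
have [phiK1 phiK2] := phi_inftyK t.
rewrite -{1}(phiK2 x) /inverse_jacobian expRN.
apply: (@is_derive_inverse _ (phi t)).
- by near=> z; exact: phiK1.
- by near=> z; exact: continuous_phi_infty.
- exact: phi_infty_dx.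
- by rewrite gt_eqF ?expR_gt0.
Unshelve. all: by end_near. Qed.

Lemma continuous_inverse_phi_infty : continuous (joint psi).
Proof.
move=> [t x].
have jphi s y : [set: R] s -> {for (s, y), continuous (joint phi)}.
  by move=> _; exact: (joint_derivs_continuous (joint_derivs_phi_infty 0)).
have cphi s : [set: R] s -> continuous (phi s) by move=> _; exact: continuous_phi_infty.
have phipsi s : [set: R] s -> cancel (phi s) (psi s) /\ cancel (psi s) (phi s).
  by move=> _; exact: phi_inftyK.
exact: (@inverse_continuous _ setT phi psi t x openT Logic.I jphi cphi phipsi).
Qed.

Lemma inverse_phi_infty_dt t x : is_derive t 1 (psi^~ x) (- I 1 t (psi t x) * E t (psi t x)).
Proof.
have ct : {for t, continuous (psi^~ x)}.
  apply: eps_continuous => e e0.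
  have /joint_continuousP/(_ e e0)[d d0 dP] := @continuous_inverse_phi_infty (t, x).
  by exists d => // s st; apply: dP; rewrite ?subrr ?normr0.
have d s y : [set: R] s -> derivable (phi s) y 1 by move=> _; have [] := phi_infty_dx s y.
have cdphi : {for (t, psi t x), continuous (joint (dx phi))}.
  have [_ _ _ [_ j]] := joint_derivs_phi_infty 1.
  have c : continuous (joint (dx phi)) :=
    @joint_derivs_continuous R 0 (dx phi) j.
  exact: c.
have phipsi s : [set: R] s -> phi s (psi s x) = x by move=> _; have [_] := phi_inftyK s; exact.
have n0 : dx phi t (psi t x) != 0 by rewrite dx_phi_infty gt_eqF ?expR_gt0.
have h := implicit_derive (psi := psi^~ x) openT Logic.I d cdphi ct phipsi
  (phi_infty_dt t (psi t x)) n0.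
by apply: (is_derive_eq h); rewrite dx_phi_infty /inverse_jacobian expRN.
Qed.

Lemma joint_derivs_inverse_jacobian k : joint_derivs k E.
Proof.
have jv := joint_derivs_comp1 smooth_derive1_u0 (joint_derivs_snd k).
have jt := joint_derivsM (joint_derivs_cst k (-1)) (joint_derivsM (joint_derivs_fst k) jv).
have -> : E = (fun t y => expR (-1 * (t * v y))).
  by apply/funext => t; apply/funext => y; rewrite /inverse_jacobian mulN1r.
exact: (joint_derivs_comp1 smooth_expR jt).
Qed.

(** Bootstrap: psi_t and psi_x are smooth functions of [(t, y)] evaluated at [y = psi t x], so
    regularity of order [k] of psi passes to them and gives order [k.+1]. *)
Lemma joint_derivs_inverse_phi_infty k : joint_derivs k psi.
Proof.
elim: k => [|k IH].
  exact: (joint_derivs0 inverse_phi_infty_dt inverse_phi_infty_dx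
    continuous_inverse_phi_infty).
have jP : joint_derivs k.+1 (fun t y => - I 1 t y * E t y).
  have -> : (fun t y => - I 1 t y * E t y) = (fun t y => -1 * I 1 t y * E t y).
    by apply/funext => t; apply/funext => y; rewrite mulN1r.
  exact: (joint_derivsM
    (joint_derivsM (joint_derivs_cst _ _) (joint_derivs_exp_primitive 1 _))
    (joint_derivs_inverse_jacobian _)).
exact: (joint_derivsS inverse_phi_infty_dt inverse_phi_infty_dx
  continuous_inverse_phi_infty (joint_derivs_comp2 jP IH)
  (joint_derivs_comp2 (joint_derivs_inverse_jacobian k.+1) IH)).
Qed.

Lemma smooth_flow_phi_infty : smooth_flow [set: R] (phi_infty u0).
Proof.
have sphi : smooth_on [set: R] phi.
  by apply/joint_derivs_smooth; exact: joint_derivs_phi_infty.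
have spsi : smooth_on [set: R] psi.
  by apply/joint_derivs_smooth; exact: joint_derivs_inverse_phi_infty.
split; first exact: sphi.
move=> t _; split; first exact: bij_phi_infty.
- exact: (smooth_on_smooth sphi Logic.I).
- exact: (smooth_on_smooth spsi Logic.I).
Qed.

Lemma dx_u_infty t x : dx (u_infty u0) t x = v (psi t x).
Proof.
rewrite (dx_velocity smooth_flow_phi_infty)// dt_phi_infty dx_phi_infty.
have -> : dx (I 1) t (psi t x) = g 1 t (psi t x).
  exact: (derive1_is_derive (exp_primitive_dx 1 t _)).
by rewrite /exp_integrand expr1 subr0 mulfK// gt_eqF ?expR_gt0.
Qed.

Lemma eulerian_u_infty : eulerian_equation [set: R] (u_infty u0).
Proof.
apply/(eulerian_lagrangian openT smooth_flow_phi_infty) => t x _.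
rewrite (_ : (fun s y => dx (dt phi) s y / dx phi s y) = fun _ y => v y).
  by rewrite /dt derive1_cst.
apply/funext => s; apply/funext => y; rewrite dt_phi_infty dx_phi_infty.
have -> : dx (I 1) s y = g 1 s y.
  exact: (derive1_is_derive (exp_primitive_dx 1 s y)).
by rewrite /exp_integrand expr1 subr0 mulfK// gt_eqF ?expR_gt0.
Qed.

Lemma smooth_on_u_infty : smooth_on [set: R] (u_infty u0).
Proof.
apply/joint_derivs_smooth => k.
have -> : u_infty u0 = fun t x => I 1 t (psi t x) by rewrite /u_infty /velocity dt_phi_infty.
exact: (joint_derivs_comp2 (joint_derivs_exp_primitive 1 k.+1)
  (joint_derivs_inverse_phi_infty k)).
Qed.

Lemma cvg_derive1_u0_Ny : v x @[x --> -oo] --> (0 : R).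
Proof.
exact: (@L1_derive1_cvgNy _ v (@smooth_derive1_u0 0%N)
  (smooth_continuous (n := 1) smooth_derive1_u0) (L1_derive1_u0 0%N)
  (L1_derive1_u0 1%N)).
Qed.

Lemma cvg_derive1_u0_y : v x @[x --> +oo] --> (0 : R).
Proof.
exact: (@L1_derive1_cvgy _ v (@smooth_derive1_u0 0%N)
  (smooth_continuous (n := 1) smooth_derive1_u0) (L1_derive1_u0 0%N)
  (L1_derive1_u0 1%N)).
Qed.

Lemma derive1_phi_infty t : (phi t)^`() = fun x => expR (t * v x).
Proof. by apply/funext => x; exact: (derive1_is_derive (phi_infty_dx t x)). Qed.

Lemma cvg_phi_infty_Ny t : phi t x @[x --> -oo] --> -oo.
Proof.
have [B phiB] := phi_infty_bound t; apply/cvgrNyPle => A; near=> x.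
have /andP[_ h] := phiB x; apply: le_trans h _; rewrite -lerBrDr.
by near: x; apply: nbhs_ninfty_le; exact: num_real.
Unshelve. all: by end_near. Qed.

Lemma cvg_phi_infty_y t : phi t x @[x --> +oo] --> +oo.
Proof.
have [B phiB] := phi_infty_bound t; apply/cvgryPge => A; near=> x.
have /andP[h _] := phiB x; apply: le_trans _ h; rewrite lerBrDr.
by near: x; apply: nbhs_pinfty_ge; exact: num_real.
Unshelve. all: by end_near. Qed.

Lemma cvg_inverse_phi_infty_Ny t : psi t x @[x --> -oo] --> -oo.
Proof.
have [B phiB] := phi_infty_bound t; apply/cvgrNyPle => A; near=> x.
have /andP[h _] := phiB (psi t x); have [_ pK] := phi_inftyK t; rewrite pK in h.
rewrite (@le_trans _ _ (x + B))//; first by rewrite -lerBlDr.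
rewrite -lerBrDr.
by near: x; apply: nbhs_ninfty_le; exact: num_real.
Unshelve. all: by end_near. Qed.

Lemma continuous_inverse_phi_infty_x t : continuous (psi t).
Proof. by move=> x; apply: derivable_continuous; have [] := inverse_phi_infty_dx t x. Qed.

(** Substituting x = phi(t, y) turns the integral of |a o psi| into that of |a| exp(t u0'), whose
    second factor is bounded. The substitution theorem asks for limits of phi_x at both ends; they
    exist because [u0'] tends to 0 there. *)
Lemma L1_comp_inverse_phi_infty a t : bounded_L1 a -> L1 (a \o psi t).
Proof.
move=> [[ca [M aM]] La]; have capsi : continuous (a \o psi t).
  by move=> x; apply: continuous_comp; [exact: continuous_inverse_phi_infty_x|exact: ca].
apply/integrableP; split.
  by apply/measurable_EFinP; exact: continuous_measurable_fun.
have cexp : continuous (fun x => expR (t * v x)).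
  by move=> x; rewrite -derive1_phi_infty; apply: (smooth_continuous (n := 1) (f := phi t));
     have [] := smooth_flow_phi_infty.2 t Logic.I.
have lim (F : set_system R) : Filter F -> v x @[x --> F] --> (0 : R) ->
    cvg (expR (t * v x) @[x --> F]).
  move=> FF v0; apply/cvg_ex; exists (expR (t * 0)).
  apply: continuous_cvg; first exact: continuous_expR.
  by apply: cvgM; [exact: cvg_cst|exact: v0].
have dphi x : derivable (phi t) x 1 by have [] := phi_infty_dx t x.
have cphi' : continuous (phi t)^`() by rewrite derive1_phi_infty.
have lNy : cvg ((phi t)^`()%classic x @[x --> -oo]).
  by rewrite derive1_phi_infty; exact: lim cvg_derive1_u0_Ny.
have ly : cvg ((phi t)^`()%classic x @[x --> +oo]).
  by rewrite derive1_phi_infty; exact: lim cvg_derive1_u0_y.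
pose G := Num.norm \o (a \o psi t).
have cG : continuous G.
  move=> x; apply: (@continuous_comp _ _ _ (a \o psi t) Num.norm).
    exact: capsi.
  exact: norm_continuous.
have G0 x : 0 <= G x by exact: normr_ge0.
have h := increasing_ge0_integration_by_substitutionT (@phi_infty_lt t) cphi' lNy ly
  dphi (@cvg_phi_infty_Ny t) (@cvg_phi_infty_y t) cG G0.
have hE : (\int[mu]_x (((G \o phi t) * (phi t)^`()%classic) x)%:E =
    \int[mu]_x ((Num.norm \o a) x * expR (t * v x))%:E)%E.
  apply: eq_integral => x _; congr (_%:E); rewrite derive1_phi_infty.
  rewrite -[LHS]/(`|a (psi t (phi t x))| * expR (t * v x)).
  by have [-> _] := phi_inftyK t.
rewrite -[X in (X < _)%E]/(\int[mu]_x (G x)%:E)%E h hE.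
have LE : bounded_L1 ((Num.norm \o a) * (fun x => expR (t * v x))).
  apply: bounded_L1M.
    split; last exact: integrable_norm.
    split; last by exists M => x /=; rewrite normr_id.
    by move=> x; apply: continuous_comp; [exact: ca|exact: norm_continuous].
  split; first exact: cexp.
  have [N N0 vN] := derive1_u0_bound; exists (expR (`|t| * N)) => x.
  rewrite ger0_norm ?expR_ge0// ler_expR (le_trans (ler_norm _))//.
  by rewrite normrM ler_wpM2l.
have /integrableP[_ h'] := LE.2; apply: le_lt_trans h'.
rewrite le_eqVlt; apply/orP; left; apply/eqP; apply: eq_integral => x _.
have nn : 0 <= (Num.norm \o a) x * expR (t * v x).
  exact: mulr_ge0 (normr_ge0 _) (expR_ge0 _).
exact: (congr1 EFin (esym (ger0_norm nn))).
Qed.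

(** The derivative is - t u0'' times the function itself, so the order is raised by the product
    rule. *)
Lemma derivs_inverse_jacobian n t : derivs bounded_continuous n (E t).
Proof.
have dc m (b : R) : derivs bounded_continuous m (cst b).
  elim: m b => [|m IH] b; (split; [|by move=> x; exact: derivable_cst|]) => //.
  - by split; [move=> x; exact: cvg_cst|exists `|b|].
  - by split; [move=> x; exact: cvg_cst|exists `|b|].
  have -> : (cst b)^`() = cst 0 :> (R -> R) by apply/funext => x; exact: derive1_cst.
  exact: IH.
have dvc m : derivs bounded_continuous m v^`().
  have [_ _] := derivs_derive1_u0 m.+1; apply: derivs_impl => f; by case.
have E_dx x : is_derive x 1 (E t) (dx E t x).
  exact: (joint_derivs_is_derive_dx t x (joint_derivs_inverse_jacobian 0)).
have bE : bounded_continuous (E t).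
  split; first by move=> x; apply: derivable_continuous; have [] := E_dx x.
  have [N N0 vN] := derive1_u0_bound; exists (expR (`|t| * N)) => x.
  rewrite ger0_norm ?expR_ge0// ler_expR (le_trans (ler_norm _))//.
  by rewrite normrN normrM ler_wpM2l.
have dE x : derivable (E t) x 1 by have [] := E_dx x.
elim: n => [|n IH]; split=> //.
have -> : (E t)^`() = (cst (- t) * v^`()%classic) * E t.
  apply/funext => x; apply: derive1_is_derive.
  have dvx := is_derive_derive1 (@smooth_derive1_u0 0%N x).
  have iv := is_deriveN (is_deriveZ t dvx).
  apply: (is_derive_eq (is_derive1_comp (is_derive_expR _) iv)).
  rewrite -[LHS]/(expR (- (t * v x)) * - (t * v^`()%classic x)).
  rewrite -[RHS]/(- t * v^`()%classic x * expR (- (t * v x))).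
  by rewrite mulrC -mulNr.
apply: (derivsM (Q := bounded_continuous)) => //.
- exact: bounded_continuousD.
- exact: bounded_continuousM.
apply: (derivsM (Q := bounded_continuous)) => //.
- exact: bounded_continuousD.
- exact: bounded_continuousM.
Qed.

(** Since (a o psi)' = (a' E) o psi and [a' E] satisfies the same hypothesis as [a], the induction
    runs over all [a]. *)
Lemma L1_comp_inverse_phi_infty_derive1n a t n : (forall k, derivs bounded_L1 k a) ->
  L1 (a \o psi t)^`(n).
Proof.
elim: n a => [|n IH] a da; first by have [+ _ _] := da 0%N; exact: L1_comp_inverse_phi_infty.
rewrite derive1Sn.
have -> : (a \o psi t)^`() = (a^`()%classic * E t) \o psi t.
  apply/funext => x; apply: derive1_is_derive.
  have [_ d _] := da 0%N.
  exact: (is_derive1_comp (is_derive_derive1 (d (psi t x))) (inverse_phi_infty_dx t x)).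
apply: IH => k; apply: (derivsM (Q := bounded_continuous)).
- exact: bounded_L1D.
- exact: bounded_L1M.
- by have [] := da k.+1.
- exact: derivs_inverse_jacobian.
Qed.

Lemma admissible_u_infty : admissible_field [set: R] (u_infty u0).
Proof.
split=> [|t _]; first exact: smooth_on_u_infty.
have E1 : (u_infty u0 t)^`() = v \o psi t by apply/funext => x; exact: dx_u_infty.
split.
- exact: (smooth_on_smooth smooth_on_u_infty Logic.I).
- rewrite E1; apply: sobolev1_infty_smooth; last first.
    by move=> n; apply: L1_comp_inverse_phi_infty_derive1n => k; exact: derivs_derive1_u0.
  by rewrite -E1; exact: (smooth_on_smooth (smooth_on_dx smooth_on_u_infty) Logic.I).
have -> : u_infty u0 t = I 1 t \o psi t.
  by apply/funext => x; rewrite /u_infty /velocity dt_phi_infty.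
apply: (cvg_comp _ _ (@cvg_inverse_phi_infty_Ny t)).
exact: (cvg_RintegralNy (L1_exp_integrand 1 t)).
Qed.

End phi_infty_theory.

(** * Essential suprema of continuous functions *)

Section Linfty.
Context {R : realType}.
Notation mu := (@lebesgue_measure R).
Implicit Types (f h : R -> R) (x : R) (y : \bar R).

(** By continuity, a point where [f] exceeds [y] has a whole ball of such points, of positive
    measure. The bound [y] is an extended real because the essential supremum is an infimum over
    extended reals. *)
Lemma ae_le_continuous f y : continuous f ->
  (\forall x \ae mu, ((f x)%:E <= y)%E) <-> forall x, ((f x)%:E <= y)%E.
Proof.
move=> cf; split=> [[A [mA A0 fA]] x|fy]; last exact: aeW.
rewrite leNgt; apply/negP => yfx.
have [d d0 dP] : exists2 d, 0 < d & forall z, `|z - x| < d -> (y < (f z)%:E)%E.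
  case: y yfx {fA} => [r| |]; first last.
  - by move=> _; exists 1 => // z _; rewrite ltNyr.
  - by rewrite ltNge leey.
  rewrite lte_fin => rfx; have e0 : 0 < f x - r by rewrite subr_gt0.
  have [d d0 dP] := continuous_eps (cf x) e0.
  exists d => // z /dP; rewrite ltr_norml lte_fin => /andP[+ _]; lra.
have : (mu (ball x d) <= mu A)%E.
  apply: le_measure; rewrite ?inE//; first exact: measurable_ball.
  move=> z; rewrite /ball/= distrC => /dP yfz; apply: fA => /=.
  by rewrite leNgt yfz.
rewrite A0 (lebesgue_measure_ball _ (ltW d0)).
by rewrite -[0%E]/((0 : R)%:E) lee_fin leNgt mulrn_wgt0.
Qed.

(** [h] may distort Lebesgue measure; but for continuous functions essential upper bounds are true
    upper bounds, and these depend only on the set of values, which a surjective [h] leaves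
    unchanged. *)
Lemma Linfty_norm_comp f h : continuous f -> continuous (f \o h) ->
  (forall x, exists z, h z = x) -> Linfty_norm (f \o h) = Linfty_norm f.
Proof.
move=> cf cfh hsurj.
have mT : (0 < mu [set: R])%E.
  by rewrite -set_itvNyy lebesgue_measure_itv/= lt0y.
have cn (k : R -> R) : continuous k -> continuous (Num.norm \o k).
  move=> ck x; apply: (@continuous_comp _ _ _ k Num.norm); first exact: ck.
  exact: norm_continuous.
rewrite /Linfty_norm unlock /= mT /ess_sup; congr ereal_inf.
apply/seteqP; split=> y /=.
  move=> /(ae_le_continuous y (cn _ cfh)) h1.
  by apply/(ae_le_continuous y (cn _ cf)) => x; have [z <-] := hsurj x; exact: h1.
move=> /(ae_le_continuous y (cn _ cf)) h1.
by apply/(ae_le_continuous y (cn _ cfh)) => x; exact: h1.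
Qed.

End Linfty.

Theorem corollary2p8p2 (R : realType) (u0 : R -> R) (hu0 : g_minus_infty u0) :
  (* well-definedness of the inverse of phi^oo and of u^oo *)
  smooth_flow [set: R] (phi_infty u0) /\
  admissible_field [set: R] (u_infty u0) /\
  eulerian_equation [set: R] (u_infty u0) /\
  (* Eulerian versus Lagrangian form of the equation *)
  (forall (J : set R) (phi : R -> R -> R), open J -> smooth_flow J phi ->
     (eulerian_equation J (velocity phi) <-> lagrangian_equation J phi)) /\
  (forall (J : set R) (u : R -> R -> R), open J -> admissible_field J u ->
     (eulerian_equation J u <-> generalized_proudman_johnson 0 J u)) /\
  (forall t x : R,
     dx (u_infty u0) t x = u0^`()%classic (flow_inverse (phi_infty u0) t x)) /\
  (forall t : R, Linfty_norm (dx (u_infty u0) t) = Linfty_norm u0^`()).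
Proof.
split; first exact: smooth_flow_phi_infty.
split; first exact: admissible_u_infty.
split; first exact: eulerian_u_infty.
split; first by move=> J phi oJ sphi; exact: eulerian_lagrangian.
split; first by move=> J u oJ au; exact: eulerian_proudman_johnson.
split; first exact: dx_u_infty.
move=> t; have [s0 _ _] := hu0.
have [su _] := admissible_u_infty hu0.
have E : dx (u_infty u0) t = u0^`()%classic \o flow_inverse (phi_infty u0) t.
  by apply/funext => x; exact: dx_u_infty.
have cdu : continuous (dx (u_infty u0) t).
  exact: (smooth_continuous (n := 0) (smooth_on_smooth (smooth_on_dx su) I)).
rewrite E in cdu *; apply: Linfty_norm_comp => //.
  exact: (smooth_continuous (n := 1) s0).
move=> x; exists (phi_infty u0 t x).
have [phiK _] := flowK (smooth_flow_phi_infty hu0) (I : [set: R] t).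
exact: phiK.
Qed.
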